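(* Consider the class of equations $$u_t+uu_x+\beta(t)u_{xxxxx}=0,\qquad \beta\ne0,$$ where $\beta$ is a smooth function of $t$. The kernel of the maximal Lie invariance algebras of equations from this class is the two-dimensional Abelian algebra $A^{\rm ker}=\langle\partial_x,\ t\partial_x+\partial_u\rangle$. All possible $G^\sim_{\alpha=0}$-inequivalent cases of extension of the maximal Lie invariance algebra $A^{\max}$ (i.e. of $A^{\max}\ne A^{\rm ker}$) are exhausted by the following cases: 1. $\beta=t^\rho$: $A^{\max}=\langle\partial_x,\ t\partial_x+\partial_u,\ 5t\partial_t+(\rho+1)x\partial_x+(\rho-4)u\partial_u\rangle$; 2. $\beta=e^{t}$: $A^{\max}=\langle\partial_x,\ t\partial_x+\partial_u,\ 5\partial_t+x\partial_x+u\partial_u\rangle$; 3. $\beta=(t^2+1)^{3/2}e^{5\nu\arctan t}$: $A^{\max}=\langle\partial_x,\ t\partial_x+\partial_u,\ (t^2+1)\partial_t+(t+\nu)x\partial_x+((\nu-t)u+x)\partial_u\rangle$; 4. $\beta=1$: $A^{\max}=\langle\partial_x,\ t\partial_x+\partial_u,\ \partial_t,\ 5t\partial_t+x\partial_x-4u\partial_u\rangle$. Here $\rho$ and $\nu$ are real constants, $\rho\neq0$, and up to $G^\sim_{\alpha=0}$-equivalence they are normalized by $\rho\leqslant 3/2$ and $\nu\geqslant0$.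
   Context: All considerations are local, with real-valued smooth functions on suitable intervals of $t$ (e.g. $t>0$ for $t^\rho$). The maximal Lie invariance algebra $A^{\max}$ of an equation is the Lie algebra of all vector fields $Q=\tau(t,x,u)\partial_t+\xi(t,x,u)\partial_x+\eta(t,x,u)\partial_u$ satisfying the infinitesimal invariance criterion, i.e. the fifth prolongation $Q^{(5)}$ applied to $u_t+uu_x+\beta(t)u_{xxxxx}$ vanishes on the manifold defined by the equation in the fifth-order jet space. The kernel is the intersection of the maximal Lie invariance algebras of all equations in the class. $G^\sim_{\alpha=0}$ is the group of transformations $$\tilde t=\frac{at+b}{ct+d},\quad \tilde x=\frac{e_2x+e_1t+e_0}{ct+d},\quad \tilde u=\frac{e_2(ct+d)u-e_2cx-e_0c+e_1d}{\Delta},\quad \tilde\beta=\frac{e_2^5}{(ct+d)^3}\frac{\beta}{\Delta},$$ with constants $a,b,c,d,e_0,e_1,e_2$, $\Delta=ad-bc\neq0$, $e_2\neq0$. Two equations of the class are $G^\sim_{\alpha=0}$-equivalent if such a transformation maps one to the other. *)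

(* Defs.v *)
From Stdlib Require Import Reals List.
From Coquelicot Require Import Coquelicot.
Import ListNotations.
Open Scope R_scope.

Definition is_open_interval (I : R -> Prop) : Prop :=
  exists lo hi : Rbar, Rbar_lt lo hi /\
    forall t : R, I t <-> Rbar_lt lo t /\ Rbar_lt t hi.

Definition subset (I J : R -> Prop) : Prop := forall t : R, I t -> J t.

(* An equation u_t + u u_x + beta(t) u_xxxxx = 0 is a function beta together
   with the interval of t on which it is considered; the values of beta
   outside that interval are irrelevant. *)
Record equation : Type := Eqn { dom : R -> Prop; beta : R -> R }.

Definition in_class (E : equation) : Prop :=
  is_open_interval (dom E) /\
  (forall (n : nat) (t : R), dom E t -> ex_derive_n (beta E) n t) /\
  (forall t : R, dom E t -> beta E t <> 0).

Definition box (I X U : R -> Prop) (t x u : R) : Prop := I t /\ X x /\ U u.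

Definition pd_t (f : R -> R -> R -> R) (t x u : R) : R :=
  Derive (fun s => f s x u) t.
Definition pd_x (f : R -> R -> R -> R) (t x u : R) : R :=
  Derive (fun s => f t s u) x.
Definition pd_u (f : R -> R -> R -> R) (t x u : R) : R :=
  Derive (fun s => f t x s) u.

(* f is of class C^n on D (meant for open D); continuity is joint. *)
Fixpoint class_C (n : nat) (D : R -> R -> R -> Prop)
    (f : R -> R -> R -> R) : Prop :=
  (forall t x u : R, D t x u ->
     continuous (fun q : R * R * R => f (fst (fst q)) (snd (fst q)) (snd q))
       (t, x, u)) /\
  match n with
  | O => True
  | S k =>
      (forall t x u : R, D t x u ->
         ex_derive (fun s => f s x u) t /\
         ex_derive (fun s => f t s u) x /\
         ex_derive (fun s => f t x s) u) /\
      class_C k D (pd_t f) /\ class_C k D (pd_x f) /\ class_C k D (pd_u f)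
  end.

Definition smooth (D : R -> R -> R -> Prop) (f : R -> R -> R -> R) : Prop :=
  forall n : nat, class_C n D f.

(* Q = tau d_t + xi d_x + eta d_u *)
Record vfield : Type := VF {
  tau : R -> R -> R -> R;
  xi  : R -> R -> R -> R;
  eta : R -> R -> R -> R }.

Definition smooth_vf (D : R -> R -> R -> Prop) (Q : vfield) : Prop :=
  smooth D (tau Q) /\ smooth D (xi Q) /\ smooth D (eta Q).

Definition vf_eq_on (D : R -> R -> R -> Prop) (Q1 Q2 : vfield) : Prop :=
  forall t x u : R, D t x u ->
    tau Q1 t x u = tau Q2 t x u /\
    xi Q1 t x u = xi Q2 t x u /\
    eta Q1 t x u = eta Q2 t x u.

Definition vf_zero : vfield :=
  VF (fun _ _ _ => 0) (fun _ _ _ => 0) (fun _ _ _ => 0).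

Definition vf_axpy (a : R) (Q1 Q2 : vfield) : vfield :=
  VF (fun t x u => a * tau Q1 t x u + tau Q2 t x u)
     (fun t x u => a * xi Q1 t x u + xi Q2 t x u)
     (fun t x u => a * eta Q1 t x u + eta Q2 t x u).

Fixpoint lincomb (cs : list R) (Qs : list vfield) : vfield :=
  match cs, Qs with
  | c :: cs', Q :: Qs' => vf_axpy c Q (lincomb cs' Qs')
  | _, _ => vf_zero
  end.

Definition in_span (D : R -> R -> R -> Prop) (Qs : list vfield)
    (Q : vfield) : Prop :=
  exists cs : list R, length cs = length Qs /\ vf_eq_on D Q (lincomb cs Qs).

Definition lin_indep (D : R -> R -> R -> Prop) (Qs : list vfield) : Prop :=
  forall cs : list R, length cs = length Qs ->
    vf_eq_on D (lincomb cs Qs) vf_zero -> forall c : R, In c cs -> c = 0.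

Definition vf_act (Q : vfield) (f : R -> R -> R -> R) (t x u : R) : R :=
  tau Q t x u * pd_t f t x u + xi Q t x u * pd_x f t x u
  + eta Q t x u * pd_u f t x u.

Definition bracket (Q1 Q2 : vfield) : vfield :=
  VF (fun t x u => vf_act Q1 (tau Q2) t x u - vf_act Q2 (tau Q1) t x u)
     (fun t x u => vf_act Q1 (xi Q2) t x u - vf_act Q2 (xi Q1) t x u)
     (fun t x u => vf_act Q1 (eta Q2) t x u - vf_act Q2 (eta Q1) t x u).

(* p i j is the jet coordinate of d^(i+j) u / dt^i dx^j; in particular p 0 0
   is u.  Coordinates of every order are carried, but a differential function
   of order n only depends on those with i + j <= n, so quantifying over jets
   in statements about order n is quantifying over the n-th jet space. *)
Definition jet : Type := nat -> nat -> R.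
Definition dfun : Type := R -> R -> jet -> R.

Definition upd (p : jet) (i j : nat) (s : R) : jet :=
  fun a b => if andb (Nat.eqb a i) (Nat.eqb b j) then s else p a b.

Definition lift (f : R -> R -> R -> R) : dfun :=
  fun t x p => f t x (p 0%nat 0%nat).

Definition jd_t (F : dfun) : dfun := fun t x p => Derive (fun s => F s x p) t.
Definition jd_x (F : dfun) : dfun := fun t x p => Derive (fun s => F t s p) x.
Definition jd (i j : nat) (F : dfun) : dfun :=
  fun t x p => Derive (fun s => F t x (upd p i j s)) (p i j).

Definition sum_order (n : nat) (a : nat -> nat -> R) : R :=
  sum_f_R0 (fun i => sum_f_R0 (fun j => a i j) (n - i)) n.

(* Total derivatives of a differential function F of order at most n. *)
Definition total_t (n : nat) (F : dfun) : dfun :=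
  fun t x p => jd_t F t x p + sum_order n (fun i j => p (S i) j * jd i j F t x p).
Definition total_x (n : nat) (F : dfun) : dfun :=
  fun t x p => jd_x F t x p + sum_order n (fun i j => p i (S j) * jd i j F t x p).

(* Coefficient eta^(i,j) of d/du_(i,j) in the prolongation of Q, by
     eta^(J,k) = D_k eta^J - u_(J,t) D_k tau - u_(J,x) D_k xi,
   applying first the x- and then the t-steps; eta^(i,j) has order i + j. *)
Fixpoint pr_coef_x (Q : vfield) (j : nat) : dfun :=
  match j with
  | O => lift (eta Q)
  | S k => fun t x p =>
      total_x k (pr_coef_x Q k) t x p
      - p 1%nat k * total_x 0 (lift (tau Q)) t x p
      - p 0%nat (S k) * total_x 0 (lift (xi Q)) t x p
  end.

Fixpoint pr_coef (Q : vfield) (i j : nat) : dfun :=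
  match i with
  | O => pr_coef_x Q j
  | S k => fun t x p =>
      total_t (k + j) (pr_coef Q k j) t x p
      - p (S k) j * total_t 0 (lift (tau Q)) t x p
      - p k (S j) * total_t 0 (lift (xi Q)) t x p
  end.

Definition prolong (n : nat) (Q : vfield) (F : dfun) : dfun :=
  fun t x p =>
    lift (tau Q) t x p * jd_t F t x p + lift (xi Q) t x p * jd_x F t x p
    + sum_order n (fun i j => pr_coef Q i j t x p * jd i j F t x p).

Definition lhs (E : equation) : dfun :=
  fun t x p =>
    p 1%nat 0%nat + p 0%nat 0%nat * p 0%nat 1%nat + beta E t * p 0%nat 5%nat.

(* X and U are the intervals of x and u on which the vector fields live. *)
Definition A_max (X U : R -> Prop) (E : equation) (Q : vfield) : Prop :=
  smooth_vf (box (dom E) X U) Q /\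
  forall (t x : R) (p : jet), box (dom E) X U t x (p 0%nat 0%nat) ->
    lhs E t x p = 0 -> prolong 5 Q (lhs E) t x p = 0.

Definition kernel (I X U : R -> Prop) (Q : vfield) : Prop :=
  forall b : R -> R, in_class (Eqn I b) -> A_max X U (Eqn I b) Q.

Definition ker_basis : list vfield :=
  [ VF (fun _ _ _ => 0) (fun _ _ _ => 1) (fun _ _ _ => 0);
    VF (fun _ _ _ => 0) (fun t _ _ => t) (fun _ _ _ => 1) ].

Definition A_ker (I X U : R -> Prop) (Q : vfield) : Prop :=
  in_span (box I X U) ker_basis Q.

(* A_max <> A_ker, as sets of vector fields on the box *)
Definition extends_kernel (X U : R -> Prop) (E : equation) : Prop :=
  ~ (forall Q : vfield, A_max X U E Q <-> A_ker (dom E) X U Q).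

Record transf : Type := Transf {
  ca : R; cb : R; cc : R; cd : R; e0 : R; e1 : R; e2 : R }.

Definition g_det (g : transf) : R := ca g * cd g - cb g * cc g.

Definition is_transf (g : transf) : Prop := g_det g <> 0 /\ e2 g <> 0.

Definition t_new (g : transf) (t : R) : R :=
  (ca g * t + cb g) / (cc g * t + cd g).
Definition x_new (g : transf) (t x : R) : R :=
  (e2 g * x + e1 g * t + e0 g) / (cc g * t + cd g).
Definition u_new (g : transf) (t x u : R) : R :=
  (e2 g * (cc g * t + cd g) * u - e2 g * cc g * x - e0 g * cc g + e1 g * cd g)
  / g_det g.
Definition beta_new (g : transf) (t b : R) : R :=
  e2 g ^ 5 / (cc g * t + cd g) ^ 3 * (b / g_det g).

Definition graph (E : equation) (t x u b : R) : Prop :=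
  dom E t /\ b = beta E t.

(* g is defined over the whole interval of E, and its action on the
   (t,x,u,beta)-space takes the graph of E exactly onto that of E'. *)
Definition maps_to (g : transf) (E E' : equation) : Prop :=
  (forall t : R, dom E t -> cc g * t + cd g <> 0) /\
  forall t' x' u' b' : R,
    graph E' t' x' u' b' <->
    exists t x u b : R, graph E t x u b /\
      t' = t_new g t /\ x' = x_new g t x /\ u' = u_new g t x u /\
      b' = beta_new g t b.

Definition equivalent (E E' : equation) : Prop :=
  exists g : transf, is_transf g /\ maps_to g E E'.

Inductive case : Type :=
| Power (rho : R)
| Expon
| Arctan (nu : R)
| Constant.

Definition case_beta (c : case) (t : R) : R :=
  match c with
  | Power rho => Rpower t rho
  | Expon => exp t
  | Arctan nu => Rpower (t ^ 2 + 1) (3 / 2) * exp (5 * nu * atan t)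
  | Constant => 1
  end.

Definition case_dom (c : case) (t : R) : Prop :=
  match c with
  | Power _ => 0 < t
  | _ => True
  end.

Definition case_basis (c : case) : list vfield :=
  ker_basis ++
  match c with
  | Power rho =>
      [ VF (fun t _ _ => 5 * t) (fun _ x _ => (rho + 1) * x)
           (fun _ _ u => (rho - 4) * u) ]
  | Expon =>
      [ VF (fun _ _ _ => 5) (fun _ x _ => x) (fun _ _ u => u) ]
  | Arctan nu =>
      [ VF (fun t _ _ => t ^ 2 + 1) (fun t x _ => (t + nu) * x)
           (fun t x u => (nu - t) * u + x) ]
  | Constant =>
      [ VF (fun _ _ _ => 1) (fun _ _ _ => 0) (fun _ _ _ => 0);
        VF (fun t _ _ => 5 * t) (fun _ x _ => x) (fun _ _ u => - 4 * u) ]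
  end.

Definition case_param (c : case) : Prop :=
  match c with
  | Power rho => rho <> 0 /\ rho <= 3 / 2
  | Arctan nu => 0 <= nu
  | _ => True
  end.

Definition case_interval (c : case) (I : R -> Prop) : Prop :=
  is_open_interval I /\ subset I (case_dom c).

(* Main.v *)
Require Import Defs.
From Stdlib Require Import Reals List.
From Coquelicot Require Import Coquelicot.
From Stdlib Require Import Lra Classical.
Import ListNotations.
Open Scope R_scope.

(* Solving the equation for [u_t] leaves all other jet coordinates free, so the
   invariance condition is a differential polynomial vanishing identically on
   the box, and so are its derivatives along jet coordinates. Those along
   [u_txxxx], [u_xxxxx u_x], [u_xxxxx], [u_xx u_xxx], [u_xxxx] and [u_x] give in
   turn [tau_x = tau_u = 0], [xi_u = 0],
   [tau beta' + beta tau_t = 5 beta xi_x], [eta_uu = 0], [eta_xu = 0] and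
   [eta = xi_t + u (xi_x - tau_t)]; what remains makes [tau] quadratic in [t]
   and [xi] affine in [x]. Hence, modulo the kernel, symmetries correspond to
   quadratic polynomials [tau] and constants [kappa] with
   [tau beta' = (3/2 tau' + kappa) beta]. The group acts on [tau d/dt] by
   Moebius maps of the line and preserves [kappa] and the discriminant of
   [tau], which separates the listed cases. Conversely, moving the roots of
   [tau] to normal position determines [beta] up to a constant factor, which
   [e2] absorbs; a root inside the interval forces [beta] to be equivalent to a
   constant, because [beta] does not vanish there. *)

(** * Reification of the prolongation formula *)

(** Under the group beta acquires the factor [(c t + d)^-3], which up to sign and a constant is the
    power 3/2 of the derivative of the Moebius map. So beta behaves like a density of weight -3/2 in
    [t], and [tau beta' - 3/2 tau' beta] is its Lie derivative along [tau]. The classifying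
    condition makes beta an eigenvector of that Lie derivative with eigenvalue [kappa]: this is the
    origin of 3/2 and the reason why neither a change of [t] nor a constant factor alters [kappa].

    The fifth prolongation is too long to be expanded by hand, hence the reified symbols. They keep
    partial derivatives as words in the order in which they are taken, so mixed derivatives in
    different orders are different atoms. Since [Derive] is total, its values carry information only
    where the function is differentiable; every identity is therefore confined to the open box on
    which [Q] is smooth.

    Equations live on intervals, so a Moebius map has to be regular on the interval and its image
    has to be shown to be an interval again. *)

Inductive dir : Type := DT | DX | DU.
Inductive coef : Type := Tau | Xi | Eta.

Definition pd (d : dir) : (R -> R -> R -> R) -> R -> R -> R -> R :=
  match d with DT => pd_t | DX => pd_x | DU => pd_u end.

Definition pds (w : list dir) (f : R -> R -> R -> R) : R -> R -> R -> R :=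
  fold_right pd f w.

Definition component (Q : vfield) (c : coef) : R -> R -> R -> R :=
  match c with Tau => tau Q | Xi => xi Q | Eta => eta Q end.

(* Differential polynomials in reified form, so that the total derivatives in
   the prolongation are computed by evaluation. In [ECoef c w] the head of [w]
   is the outermost derivative. *)
Inductive expr : Type :=
| EConst (r : R)
| EZero
| EOne
| EJet (i j : nat)
| ECoef (c : coef) (w : list dir)
| EAdd (e1 e2 : expr)
| EMul (e1 e2 : expr)
| EOpp (e : expr).

Fixpoint eval (Q : vfield) (e : expr) : dfun := fun t x p =>
  match e with
  | EConst r => r
  | EZero => 0
  | EOne => 1
  | EJet i j => p i j
  | ECoef c w => pds w (component Q c) t x (p 0%nat 0%nat)
  | EAdd e1 e2 => eval Q e1 t x p + eval Q e2 t x p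
  | EMul e1 e2 => eval Q e1 t x p * eval Q e2 t x p
  | EOpp e => - eval Q e t x p
  end.

(** [EZero] and [EOne] are separate from [EConst] because equality of real constants is not decided
    by evaluation. Matching on them removes vanishing terms while a symbol is being computed. *)
Definition sadd (e1 e2 : expr) : expr :=
  match e1, e2 with EZero, _ => e2 | _, EZero => e1 | _, _ => EAdd e1 e2 end.
Definition smul (e1 e2 : expr) : expr :=
  match e1, e2 with
  | EZero, _ => EZero | _, EZero => EZero
  | EOne, _ => e2 | _, EOne => e1
  | _, _ => EMul e1 e2
  end.
Definition sopp (e : expr) : expr :=
  match e with EZero => EZero | _ => EOpp e end.

Fixpoint derivation (dJ : nat -> nat -> expr) (dC : coef -> list dir -> expr)
    (e : expr) : expr :=
  match e with
  | EConst _ | EZero | EOne => EZero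
  | EJet i j => dJ i j
  | ECoef c w => dC c w
  | EAdd e1 e2 => sadd (derivation dJ dC e1) (derivation dJ dC e2)
  | EMul e1 e2 =>
      sadd (smul (derivation dJ dC e1) e2) (smul e1 (derivation dJ dC e2))
  | EOpp e => sopp (derivation dJ dC e)
  end.

Definition d_t : expr -> expr :=
  derivation (fun _ _ => EZero) (fun c w => ECoef c (DT :: w)).
Definition d_x : expr -> expr :=
  derivation (fun _ _ => EZero) (fun c w => ECoef c (DX :: w)).
(** The components of [Q] depend on the jet through [u] alone, so only [d_jet 0 0] differentiates
    them. *)
Definition d_jet (i j : nat) : expr -> expr :=
  derivation
    (fun a b => if andb (Nat.eqb a i) (Nat.eqb b j) then EOne else EZero)
    (fun c w => match i, j with O, O => ECoef c (DU :: w) | _, _ => EZero end).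

Fixpoint ssum (a : nat -> expr) (n : nat) : expr :=
  match n with O => a O | S k => sadd (ssum a k) (a (S k)) end.
Definition ssum_order (n : nat) (a : nat -> nat -> expr) : expr :=
  ssum (fun i => ssum (fun j => a i j) (n - i)) n.

Definition stotal_t (n : nat) (e : expr) : expr :=
  sadd (d_t e) (ssum_order n (fun i j => smul (EJet (S i) j) (d_jet i j e))).
Definition stotal_x (n : nat) (e : expr) : expr :=
  sadd (d_x e) (ssum_order n (fun i j => smul (EJet i (S j)) (d_jet i j e))).

Fixpoint spr_x (j : nat) : expr :=
  match j with
  | O => ECoef Eta []
  | S k =>
      sadd (sadd (stotal_x k (spr_x k))
        (sopp (smul (EJet 1 k) (stotal_x 0 (ECoef Tau [])))))
        (sopp (smul (EJet 0 (S k)) (stotal_x 0 (ECoef Xi []))))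
  end.

Fixpoint spr (i j : nat) : expr :=
  match i with
  | O => spr_x j
  | S k =>
      sadd (sadd (stotal_t (k + j) (spr k j))
        (sopp (smul (EJet (S k) j) (stotal_t 0 (ECoef Tau [])))))
        (sopp (smul (EJet k (S j)) (stotal_t 0 (ECoef Xi []))))
  end.

Section Prolongation.
Variables (I X U : R -> Prop).
Hypotheses (HI : open I) (HX : open X) (HU : open U).
Variable Q : vfield.
Hypothesis HQ : smooth_vf (box I X U) Q.

Lemma eval_sadd e1 e2 t x p :
  eval Q (sadd e1 e2) t x p = eval Q e1 t x p + eval Q e2 t x p.
Proof. destruct e1, e2; simpl; ring. Qed.

Lemma eval_smul e1 e2 t x p :
  eval Q (smul e1 e2) t x p = eval Q e1 t x p * eval Q e2 t x p.
Proof. destruct e1, e2; simpl; ring. Qed.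

Lemma eval_sopp e t x p : eval Q (sopp e) t x p = - eval Q e t x p.
Proof. destruct e; simpl; ring. Qed.

Lemma eval_ssum a n t x p :
  eval Q (ssum a n) t x p = sum_f_R0 (fun i => eval Q (a i) t x p) n.
Proof. induction n; simpl; [|rewrite eval_sadd, IHn]; reflexivity. Qed.

Lemma eval_ssum_order n a t x p :
  eval Q (ssum_order n a) t x p
  = sum_order n (fun i j => eval Q (a i j) t x p).
Proof.
  unfold ssum_order, sum_order; rewrite eval_ssum.
  apply sum_eq; intros; apply eval_ssum.
Qed.

(** The curve [(ct, cx, cp)] is arbitrary, so that one induction covers derivatives in [t], in [x]
    and in a jet coordinate. *)
Lemma is_derive_eval dJ dC (ct cx : R -> R) (cp : R -> jet) s e :
  (forall i j, is_derive (fun r => cp r i j) s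
     (eval Q (dJ i j) (ct s) (cx s) (cp s))) ->
  (forall c w, is_derive
     (fun r => pds w (component Q c) (ct r) (cx r) (cp r 0%nat 0%nat)) s
     (eval Q (dC c w) (ct s) (cx s) (cp s))) ->
  is_derive (fun r => eval Q e (ct r) (cx r) (cp r)) s
    (eval Q (derivation dJ dC e) (ct s) (cx s) (cp s)).
Proof.
  intros HJ HC; induction e; simpl; try (apply @is_derive_const); auto.
  - rewrite eval_sadd; apply @is_derive_plus; assumption.
  - rewrite eval_sadd, !eval_smul.
    apply (is_derive_mult (fun r => eval Q e1 (ct r) (cx r) (cp r))
             (fun r => eval Q e2 (ct r) (cx r) (cp r))); trivial.
    intros; apply Rmult_comm.
  - rewrite eval_sopp; apply @is_derive_opp; assumption.
Qed.

Lemma smooth_pd (D : R -> R -> R -> Prop) f d : smooth D f -> smooth D (pd d f).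
Proof.
  intros Hf n; destruct (Hf (S n)) as (_ & _ & Ht & Hx & Hu).
  destruct d; assumption.
Qed.

Lemma smooth_pds (D : R -> R -> R -> Prop) f w : smooth D f -> smooth D (pds w f).
Proof. intros Hf; induction w; simpl; [|apply smooth_pd]; assumption. Qed.

Lemma smooth_ex_derive (D : R -> R -> R -> Prop) f t x u : smooth D f -> D t x u ->
  ex_derive (fun s => f s x u) t /\ ex_derive (fun s => f t s u) x /\
  ex_derive (fun s => f t x s) u.
Proof. intros Hf HD; destruct (Hf 1%nat) as (_ & H & _); auto. Qed.

Lemma smooth_component c : smooth (box I X U) (component Q c).
Proof. destruct HQ as (? & ? & ?), c; assumption. Qed.

Definition on_box (p : jet) (t x : R) : Prop := box I X U t x (p 0%nat 0%nat).

Lemma pds_is_derive c w t x u : box I X U t x u ->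
  is_derive (fun s => pds w (component Q c) s x u) t
    (pds (DT :: w) (component Q c) t x u) /\
  is_derive (fun s => pds w (component Q c) t s u) x
    (pds (DX :: w) (component Q c) t x u) /\
  is_derive (fun s => pds w (component Q c) t x s) u
    (pds (DU :: w) (component Q c) t x u).
Proof.
  intros HD.
  destruct (smooth_ex_derive _ _ t x u
              (smooth_pds _ _ w (smooth_component c)) HD) as (? & ? & ?).
  repeat split; apply Derive_correct; assumption.
Qed.

Lemma is_derive_eval_t e t x p : on_box p t x ->
  is_derive (fun s => eval Q e s x p) t (eval Q (d_t e) t x p).
Proof.
  intros HD; apply (is_derive_eval _ _ (fun s => s) (fun _ => x) (fun _ => p)).
  - intros; apply @is_derive_const.
  - intros c w; exact (proj1 (pds_is_derive c w _ _ _ HD)).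
Qed.

Lemma is_derive_eval_x e t x p : on_box p t x ->
  is_derive (fun s => eval Q e t s p) x (eval Q (d_x e) t x p).
Proof.
  intros HD; apply (is_derive_eval _ _ (fun _ => t) (fun s => s) (fun _ => p)).
  - intros; apply @is_derive_const.
  - intros c w; exact (proj1 (proj2 (pds_is_derive c w _ _ _ HD))).
Qed.

(** The updated jet agrees with [p] only pointwise; induction on the expression replaces functional
    extensionality. *)
Lemma eval_upd_self e i j t x p :
  eval Q e t x (upd p i j (p i j)) = eval Q e t x p.
Proof.
  assert (Hp : forall a b, upd p i j (p i j) a b = p a b).
  { intros a b; unfold upd.
    destruct (Nat.eqb_spec a i); [|reflexivity].
    destruct (Nat.eqb_spec b j); [subst|]; reflexivity. }
  induction e; simpl; rewrite ?Hp; congruence.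
Qed.

Lemma is_derive_eval_jet e i j t x p : on_box p t x ->
  is_derive (fun s => eval Q e t x (upd p i j s)) (p i j)
    (eval Q (d_jet i j e) t x p).
Proof.
  intros HD; rewrite <- (eval_upd_self (d_jet i j e) i j).
  apply (is_derive_eval _ _ (fun _ => t) (fun _ => x) (fun s => upd p i j s)).
  - intros a b; rewrite eval_upd_self; unfold upd; simpl.
    destruct (andb _ _); simpl; [apply @is_derive_id|apply @is_derive_const].
  - intros c w; rewrite eval_upd_self; simpl.
    destruct i as [|i], j as [|j]; unfold upd; simpl;
      try apply @is_derive_const.
    exact (proj2 (proj2 (pds_is_derive c w _ _ _ HD))).
Qed.

(** Because the box is open, agreement there already forces agreement of all derivatives there. *)
Definition represents (F : dfun) (e : expr) : Prop :=
  forall t x p, on_box p t x -> F t x p = eval Q e t x p.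

Lemma represents_jd_t F e t x p : represents F e -> on_box p t x ->
  jd_t F t x p = eval Q (d_t e) t x p.
Proof.
  intros HF HD; unfold jd_t.
  rewrite <- (is_derive_unique _ _ _ (is_derive_eval_t e t x p HD)).
  destruct HD as (Ht & Hx & Hu); apply Derive_ext_loc.
  apply (filter_imp I); [intros s Hs; apply HF; repeat split|apply HI]; assumption.
Qed.

Lemma represents_jd_x F e t x p : represents F e -> on_box p t x ->
  jd_x F t x p = eval Q (d_x e) t x p.
Proof.
  intros HF HD; unfold jd_x.
  rewrite <- (is_derive_unique _ _ _ (is_derive_eval_x e t x p HD)).
  destruct HD as (Ht & Hx & Hu); apply Derive_ext_loc.
  apply (filter_imp X); [intros s Hs; apply HF; repeat split|apply HX]; assumption.
Qed.

Lemma on_box_upd p i j t x : on_box p t x ->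
  locally (p i j) (fun s => on_box (upd p i j s) t x).
Proof.
  intros (Ht & Hx & Hu).
  destruct i as [|i]; [destruct j as [|j]|].
  - apply (filter_imp U); [|apply HU; assumption].
    intros s Hs; repeat split; assumption.
  - apply filter_forall; repeat split; assumption.
  - apply filter_forall; repeat split; assumption.
Qed.

Lemma represents_jd F e i j t x p : represents F e -> on_box p t x ->
  jd i j F t x p = eval Q (d_jet i j e) t x p.
Proof.
  intros HF HD; unfold jd.
  rewrite <- (is_derive_unique _ _ _ (is_derive_eval_jet e i j t x p HD)).
  apply Derive_ext_loc.
  apply (filter_imp (fun s => on_box (upd p i j s) t x));
    [intros s Hs; apply HF | apply on_box_upd]; assumption.
Qed.

Lemma sum_order_ext n a b : (forall i j, a i j = b i j) ->
  sum_order n a = sum_order n b.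
Proof. intros H; apply sum_eq; intros; apply sum_eq; intros; apply H. Qed.

Lemma represents_total_t n F e : represents F e ->
  represents (total_t n F) (stotal_t n e).
Proof.
  intros HF t x p HD; unfold total_t, stotal_t.
  rewrite eval_sadd, eval_ssum_order, (represents_jd_t F e) by assumption.
  f_equal; apply sum_order_ext; intros i j.
  rewrite eval_smul, (represents_jd F e) by assumption; reflexivity.
Qed.

Lemma represents_total_x n F e : represents F e ->
  represents (total_x n F) (stotal_x n e).
Proof.
  intros HF t x p HD; unfold total_x, stotal_x.
  rewrite eval_sadd, eval_ssum_order, (represents_jd_x F e) by assumption.
  f_equal; apply sum_order_ext; intros i j.
  rewrite eval_smul, (represents_jd F e) by assumption; reflexivity.
Qed.

Lemma represents_lift c : represents (lift (component Q c)) (ECoef c []).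
Proof. intros t x p _; reflexivity. Qed.

Lemma represents_pr_x j : represents (pr_coef_x Q j) (spr_x j).
Proof.
  induction j as [|k IH]; [exact (represents_lift Eta)|].
  intros t x p HD; cbn [pr_coef_x spr_x].
  rewrite !eval_sadd, !eval_sopp, !eval_smul.
  rewrite (represents_total_x k _ _ IH) by assumption.
  rewrite (represents_total_x 0 _ _ (represents_lift Tau)) by assumption.
  rewrite (represents_total_x 0 _ _ (represents_lift Xi)) by assumption.
  reflexivity.
Qed.

Lemma represents_pr i j : represents (pr_coef Q i j) (spr i j).
Proof.
  induction i as [|k IH]; [exact (represents_pr_x j)|].
  intros t x p HD; cbn [pr_coef spr].
  rewrite !eval_sadd, !eval_sopp, !eval_smul.
  rewrite (represents_total_t (k + j) _ _ IH) by assumption.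
  rewrite (represents_total_t 0 _ _ (represents_lift Tau)) by assumption.
  rewrite (represents_total_t 0 _ _ (represents_lift Xi)) by assumption.
  reflexivity.
Qed.

(* Symbol of the prolongation acting on the equation at a fixed [t], where
   [b] and [b'] stand for the values of beta and its derivative. *)
Definition sinvariance (b b' : R) : expr :=
  sadd (smul (ECoef Tau []) (smul (EConst b') (EJet 0 5)))
    (sadd (spr 1 0) (sadd (smul (EJet 0 1) (ECoef Eta []))
       (sadd (smul (EJet 0 0) (spr 0 1)) (smul (EConst b) (spr 0 5))))).

Lemma prolong_lhs E t x p : dom E t -> ex_derive (beta E) t -> on_box p t x ->
  prolong 5 Q (lhs E) t x p
  = eval Q (sinvariance (beta E t) (Derive (beta E) t)) t x p.
Proof.
  intros Ht Hb HD; unfold prolong, sinvariance.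
  rewrite !eval_sadd, !eval_smul.
  rewrite <- !(represents_pr _ _ t x p HD).
  assert (Hjt : jd_t (lhs E) t x p = Derive (beta E) t * p 0%nat 5%nat).
  { change (Derive (beta E) t) with (Derive (fun s => beta E s) t).
    apply is_derive_unique; unfold lhs.
    auto_derive; [repeat split; assumption | ring]. }
  assert (Hjx : jd_x (lhs E) t x p = 0).
  { apply is_derive_unique; unfold lhs; auto_derive; [trivial | ring]. }
  rewrite Hjt, Hjx.
  (* [lhs] is affine in each jet coordinate separately, so one statement about slopes yields all 21
     partial derivatives in the sum. *)
  assert (Hj : forall i j c,
    (forall s, lhs E t x (upd p i j s) = lhs E t x (upd p i j 0) + c * s) ->
    jd i j (lhs E) t x p = c).
  { intros i j c H; apply is_derive_unique.
    apply (is_derive_ext (fun s => lhs E t x (upd p i j 0) + c * s)).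
    - intros s; symmetry; apply H.
    - auto_derive; [trivial | ring]. }
  unfold sum_order; cbn [sum_f_R0 Nat.sub].
  rewrite (Hj 1%nat 0%nat 1), (Hj 0%nat 0%nat (p 0%nat 1%nat)),
    (Hj 0%nat 1%nat (p 0%nat 0%nat)), (Hj 0%nat 5%nat (beta E t)).
  2, 3, 4, 5: intros s; unfold lhs, upd; simpl; ring.
  rewrite !(fun i j => Hj i j 0) by (intros s; unfold lhs, upd; simpl; ring).
  change (pr_coef Q 0 0 t x p) with (eta Q t x (p 0%nat 0%nat)).
  unfold lift; cbn [eval pds component fold_right]; ring.
Qed.

(** Only [u_t] itself is replaced: differentiating the equation in [x] or [t] raises its order to
    six, so coordinates such as [u_txxxx] stay free on the fifth-order manifold. *)
Fixpoint solve_ut (b : R) (e : expr) : expr :=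
  match e with
  | EJet 1 0 =>
      EOpp (EAdd (EMul (EJet 0 0) (EJet 0 1)) (EMul (EConst b) (EJet 0 5)))
  | EAdd e1 e2 => EAdd (solve_ut b e1) (solve_ut b e2)
  | EMul e1 e2 => EMul (solve_ut b e1) (solve_ut b e2)
  | EOpp e => EOpp (solve_ut b e)
  | _ => e
  end.

Lemma eval_solve_ut b e t x p :
  eval Q (solve_ut b e) t x p
  = eval Q e t x
      (upd p 1 0 (- (p 0%nat 0%nat * p 0%nat 1%nat + b * p 0%nat 5%nat))).
Proof.
  induction e; simpl; try reflexivity; try congruence.
  destruct i as [|[|i]], j as [|j]; reflexivity.
Qed.

Definition determining (b b' : R) : expr := solve_ut b (sinvariance b b').

Lemma A_max_determining E : dom E = I -> (forall t, I t -> ex_derive (beta E) t) ->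
  A_max X U E Q <->
  forall t x p, on_box p t x ->
    eval Q (determining (beta E t) (Derive (beta E) t)) t x p = 0.
Proof.
  intros HE Hb; unfold A_max, determining; rewrite HE; split.
  - intros (_ & HA) t x p HD; rewrite eval_solve_ut, <- prolong_lhs.
    + apply HA; [exact HD|]; unfold lhs, upd; simpl; ring.
    + rewrite HE; apply HD.
    + apply Hb, HD.
    + exact HD.
  - intros HA; split; [exact HQ|]; intros t x p HD Hp.
    rewrite prolong_lhs; [|rewrite HE; apply HD|apply Hb, HD|exact HD].
    (* On the equation manifold [u_t] already has the solved value, so the update changes
       nothing. *)
    rewrite <- (eval_upd_self _ 1 0), <- (HA t x p HD), eval_solve_ut.
    f_equal; f_equal; unfold lhs in Hp; lra.
Qed.

Definition d_jets (l : list (nat * nat)) (e : expr) : expr :=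
  fold_right (fun ij => d_jet (fst ij) (snd ij)) e l.

(** The determining symbol has the values of beta and its derivative at one [t] built in as numbers,
    so [t] stays fixed and only jet coordinates are differentiated. *)
Lemma eval_d_jets_zero l e t :
  (forall x p, on_box p t x -> eval Q e t x p = 0) ->
  forall x p, on_box p t x -> eval Q (d_jets l e) t x p = 0.
Proof.
  intros H; induction l as [|(i, j) l IH]; [exact H|]; intros x p HD; simpl.
  rewrite <- (is_derive_unique _ _ _ (is_derive_eval_jet _ i j t x p HD)).
  rewrite (Derive_ext_loc _ (fun _ => 0)); [apply Derive_const|].
  apply (filter_imp (fun s => on_box (upd p i j s) t x));
    [intros s Hs; apply IH | apply on_box_upd]; assumption.
Qed.

Definition coef_eq_dec (c c' : coef) : {c = c'} + {c <> c'}.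
Proof. decide equality. Defined.
Definition dir_eq_dec (d d' : dir) : {d = d'} + {d <> d'}.
Proof. decide equality. Defined.

(** Meant for reversed words: the innermost derivatives stand at the end of a word, and reversal
    makes them a prefix. *)
Fixpoint suffix_rev (v w : list dir) : option (list dir) :=
  match v, w with
  | [], _ => Some w
  | d :: v', d' :: w' => if dir_eq_dec d d' then suffix_rev v' w' else None
  | _, [] => None
  end.

(* A vanishing derivative makes all its further derivatives vanish, so only the
   innermost part of the word has to match. *)
Definition killed (ks : list (coef * list dir)) (c : coef) (w : list dir) : bool :=
  existsb (fun k => if coef_eq_dec (fst k) c
                    then match suffix_rev (rev (snd k)) (rev w) with
                         | Some _ => true | None => false end
                    else false) ks.

Fixpoint prune (ks : list (coef * list dir)) (e : expr) : expr :=
  match e with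
  | ECoef c w => if killed ks c w then EZero else e
  | EAdd e1 e2 => sadd (prune ks e1) (prune ks e2)
  | EMul e1 e2 => smul (prune ks e1) (prune ks e2)
  | EOpp e => sopp (prune ks e)
  | _ => e
  end.

Definition vanishes (f : R -> R -> R -> R) : Prop :=
  forall t x u, box I X U t x u -> f t x u = 0.

Lemma pd_ext f g d : (forall t x u, box I X U t x u -> f t x u = g t x u) ->
  forall t x u, box I X U t x u -> pd d f t x u = pd d g t x u.
Proof.
  intros H t x u (Ht & Hx & Hu); destruct d; apply Derive_ext_loc;
    [apply (filter_imp I) | apply (filter_imp X) | apply (filter_imp U)];
    auto; intros s Hs; apply H; repeat split; assumption.
Qed.

Lemma vanishes_pd f d : vanishes f -> vanishes (pd d f).
Proof.
  intros H t x u HD; rewrite (pd_ext f (fun _ _ _ => 0)) by assumption.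
  destruct d; exact (Derive_const 0 _).
Qed.

Lemma vanishes_pds f w v : vanishes (pds v f) -> vanishes (pds (w ++ v) f).
Proof. intros H; induction w; simpl; [|apply vanishes_pd]; assumption. Qed.

Lemma suffix_rev_spec v w r : suffix_rev v w = Some r -> w = v ++ r.
Proof.
  revert w; induction v as [|d v IH]; intros w; simpl; [congruence|].
  destruct w as [|d' w]; [discriminate|].
  destruct (dir_eq_dec d d') as [<-|]; [|discriminate].
  intros H; rewrite (IH w H); reflexivity.
Qed.

Definition all_vanish (ks : list (coef * list dir)) : Prop :=
  List.Forall (fun k => vanishes (pds (snd k) (component Q (fst k)))) ks.

Lemma eval_prune ks e t x p : all_vanish ks -> on_box p t x ->
  eval Q (prune ks e) t x p = eval Q e t x p.
Proof.
  intros Hk HD; induction e; simpl;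
    rewrite ?eval_sadd, ?eval_smul, ?eval_sopp; try congruence.
  destruct (killed ks c w) eqn:Hc; [simpl; symmetry|reflexivity].
  apply existsb_exists in Hc; destruct Hc as ((c', v) & Hin & Hc); simpl in Hc.
  destruct (coef_eq_dec c' c) as [->|]; [|discriminate].
  destruct (suffix_rev (rev v) (rev w)) as [r|] eqn:Hr; [|discriminate].
  apply suffix_rev_spec, (f_equal (@rev dir)) in Hr.
  rewrite rev_app_distr, !rev_involutive in Hr; rewrite Hr.
  apply vanishes_pds; [|exact HD].
  exact (proj1 (Forall_forall _ _) Hk _ Hin).
Qed.

Lemma determining_jets ks l b b' t : all_vanish ks ->
  (forall x p, on_box p t x -> eval Q (determining b b') t x p = 0) ->
  forall x p, on_box p t x ->
    eval Q (prune ks (d_jets l (determining b b'))) t x p = 0.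
Proof.
  intros Hk H x p HD; rewrite eval_prune by assumption.
  apply eval_d_jets_zero; assumption.
Qed.
End Prolongation.

(** * Real functions on open intervals *)

Lemma open_interval_open J : is_open_interval J -> open J.
Proof.
  intros (lo & hi & _ & H).
  apply (open_ext (fun t : R => Rbar_lt lo t /\ Rbar_lt t hi)).
  - intros t; symmetry; apply H.
  - apply open_and; [apply open_Rbar_gt | apply open_Rbar_lt].
Qed.

Lemma open_interval_convex J s t r : is_open_interval J ->
  J s -> J t -> s <= r <= t -> J r.
Proof.
  intros (lo & hi & _ & H) Hs Ht Hr; apply H in Hs; apply H in Ht; apply H.
  destruct Hs as (Hs & _), Ht as (_ & Ht).
  destruct lo, hi; simpl in *; lra || tauto.
Qed.

Lemma open_interval_two_points J : is_open_interval J ->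
  exists s t, J s /\ J t /\ s < t.
Proof.
  intros (lo & hi & Hlt & H).
  destruct lo as [lo| |], hi as [hi| |]; simpl in Hlt; try tauto.
  - exists (lo + (hi - lo) / 3), (lo + 2 * (hi - lo) / 3).
    rewrite !H; simpl; lra.
  - exists (lo + 1), (lo + 2); rewrite !H; simpl; lra.
  - exists (hi - 2), (hi - 1); rewrite !H; simpl; lra.
  - exists 0, 1; rewrite !H; simpl; lra.
Qed.

Lemma is_derive_zero_const J (f : R -> R) : is_open_interval J ->
  (forall t, J t -> is_derive f t 0) -> forall s t, J s -> J t -> f s = f t.
Proof.
  intros HJ Hf s t Hs Ht.
  destruct (MVT_gen f s t (fun _ => 0)) as (r & _ & Hr).
  - intros r Hr; apply Hf.
    unfold Rmin, Rmax in Hr; destruct (Rle_dec s t).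
    + apply (open_interval_convex J s t); trivial; lra.
    + apply (open_interval_convex J t s); trivial; lra.
  - intros r Hr; apply continuity_pt_filterlim, (@ex_derive_continuous _ R_NormedModule).
    exists 0; apply Hf; unfold Rmin, Rmax in Hr; destruct (Rle_dec s t).
    + apply (open_interval_convex J s t); trivial; lra.
    + apply (open_interval_convex J t s); trivial; lra.
  - lra.
Qed.

Lemma is_derive_eq_up_to_const J (f g df : R -> R) : is_open_interval J ->
  (forall t, J t -> is_derive f t (df t)) ->
  (forall t, J t -> is_derive g t (df t)) ->
  exists c, forall t, J t -> f t = g t + c.
Proof.
  intros HJ Hf Hg; destruct (open_interval_two_points J HJ) as (t0 & _ & H0 & _).
  exists (f t0 - g t0); intros t Ht.
  enough (f t - g t = f t0 - g t0) by lra.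
  apply (is_derive_zero_const J (fun r => f r - g r)); trivial.
  intros r Hr; replace 0 with (df r - df r) by ring.
  apply @is_derive_minus; auto.
Qed.

Lemma affine_vanishes J p q : is_open_interval J ->
  (forall t, J t -> p * t + q = 0) -> p = 0 /\ q = 0.
Proof.
  intros HJ H; destruct (open_interval_two_points J HJ) as (s & t & Hs & Ht & Hst).
  apply H in Hs; apply H in Ht.
  assert (Hp : p * (t - s) = 0) by lra.
  apply Rmult_integral in Hp; destruct Hp as [->|]; lra.
Qed.

(** Here [a t + k] is [xi_x], the coefficient of [u] in [eta] is [xi_x - tau_t], and [n1], [n0] are
    the components along the kernel fields [t d_x + d_u] and [d_x]. *)
Definition symmetry_field (a b c k n1 n0 : R) : vfield :=
  VF (fun t _ _ => a * t ^ 2 + b * t + c)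
     (fun t x _ => (a * t + k) * x + (n1 * t + n0))
     (fun t x u => (k - b + - a * t) * u + (a * x + n1)).

(* For [tau = a t^2 + b t + c]; [kappa] is chosen so that Moebius changes of
   [t] do not affect it. *)
Definition classifying (I : R -> Prop) (beta : R -> R) (a b c kappa : R) : Prop :=
  forall t, I t -> (a * t ^ 2 + b * t + c) * Derive beta t
                   = (3 / 2 * (2 * a * t + b) + kappa) * beta t.

(** * Determining equations *)

Ltac compute_determining :=
  match goal with
  | |- context [prune ?ks (d_jets ?l (determining ?b ?b'))] =>
      let e := eval vm_compute in (prune ks (d_jets l (determining b b'))) in
      replace (prune ks (d_jets l (determining b b'))) with e
        by (vm_compute; reflexivity)
  end; cbn [eval pds component fold_right pd]; ring.

Definition tau_kills : list (coef * list dir) := [(Tau, [DX]); (Tau, [DU])].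
(** Derivatives are not commuted: [[DU]] kills only words whose innermost derivative is in [u], so
    the [u]-derivative of [xi_x] has to be listed separately. *)
Definition xi_kills : list (coef * list dir) :=
  [(Xi, [DU]); (Xi, [DU; DX]); (Xi, [DX; DX])].
Definition eta_kills : list (coef * list dir) :=
  [(Eta, [DX; DU]); (Eta, [DU; DX]); (Eta, [DU; DX; DX]);
   (Eta, [DU; DX; DX; DX]); (Eta, [DU; DX; DX; DX; DX])].

Section DeterminingEquations.
Variables (Q : vfield) (b b' t x : R) (p : jet).
Local Notation u := (p 0%nat 0%nat).

Lemma determining_u_txxxx :
  eval Q (prune [] (d_jets [(1, 4)]%nat (determining b b'))) t x p
  = - 5 * b * (pd_x (tau Q) t x u + p 0%nat 1%nat * pd_u (tau Q) t x u).
Proof. compute_determining. Qed.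

(** The factor -5 is -6 from the fifth-order coefficient plus 1 from the term [- u_x u_t xi_u] of
    the first-order one, after [u_t] is eliminated. *)
Lemma determining_u_x_u_xxxxx :
  eval Q (prune tau_kills (d_jets [(0, 1); (0, 5)]%nat (determining b b'))) t x p
  = - 5 * b * pd_u (xi Q) t x u.
Proof. compute_determining. Qed.

(** [eta_u] cancels: the fifth-order coefficient contributes [b eta_u], and the term [u_t eta_u]
    contributes its opposite. *)
Lemma determining_u_xxxxx :
  eval Q (prune (tau_kills ++ [(Xi, [DU])])
    (d_jets [(0, 5)]%nat (determining b b'))) t x p
  = tau Q t x u * b' + b * pd_t (tau Q) t x u - 5 * b * pd_x (xi Q) t x u.
Proof. compute_determining. Qed.

Lemma determining_u_xx_u_xxx :
  eval Q (prune (tau_kills ++ xi_kills)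
    (d_jets [(0, 2); (0, 3)]%nat (determining b b'))) t x p
  = 10 * b * pd_u (pd_u (eta Q)) t x u.
Proof. compute_determining. Qed.

Lemma determining_u_xxxx :
  eval Q (prune (tau_kills ++ xi_kills ++ [(Eta, [DU; DU])])
    (d_jets [(0, 4)]%nat (determining b b'))) t x p
  = b * (4 * pd_x (pd_u (eta Q)) t x u + pd_u (pd_x (eta Q)) t x u).
Proof. compute_determining. Qed.

Lemma determining_u_x :
  eval Q (prune (tau_kills ++ xi_kills ++ (Eta, [DU; DU]) :: eta_kills)
    (d_jets [(0, 1)]%nat (determining b b'))) t x p
  = eta Q t x u - pd_t (xi Q) t x u
    - u * (pd_x (xi Q) t x u - pd_t (tau Q) t x u).
Proof. compute_determining. Qed.

Lemma determining_full :
  eval Q (prune (tau_kills ++ xi_kills ++ (Eta, [DU; DU]) :: eta_kills)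
    (d_jets [] (determining b b'))) t x p
  = p 0%nat 5%nat *
      (tau Q t x u * b' + b * pd_t (tau Q) t x u - 5 * b * pd_x (xi Q) t x u)
    + p 0%nat 1%nat *
      (eta Q t x u - pd_t (xi Q) t x u
       - u * (pd_x (xi Q) t x u - pd_t (tau Q) t x u))
    + (pd_t (eta Q) t x u + u * pd_x (eta Q) t x u
       + b * pd_x (pd_x (pd_x (pd_x (pd_x (eta Q))))) t x u).
Proof. compute_determining. Qed.
End DeterminingEquations.

(** * Integration of the determining equations *)

Section Symmetries.
Variables I X U : R -> Prop.
Hypotheses (HI : is_open_interval I) (HX : is_open_interval X)
  (HU : is_open_interval U).
Let oI : open I := open_interval_open I HI.
Let oX : open X := open_interval_open X HX.
Let oU : open U := open_interval_open U HU.
Variable beta : R -> R.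
Hypothesis beta_derivable : forall t, I t -> ex_derive beta t.
Hypothesis beta_nonzero : forall t, I t -> beta t <> 0.
Notation D := (box I X U).

Section Forward.
Variable Q : vfield.
Hypothesis HQ : A_max X U (Eqn I beta) Q.
Variables x0 u0 : R.
Hypotheses (Hx0 : X x0) (Hu0 : U u0).

Lemma A_max_smooth : smooth_vf D Q.
Proof. exact (proj1 HQ). Qed.

Lemma field_derivable f t x u : smooth D f -> D t x u ->
  is_derive (fun s => f s x u) t (pd DT f t x u) /\
  is_derive (fun s => f t s u) x (pd DX f t x u) /\
  is_derive (fun s => f t x s) u (pd DU f t x u).
Proof.
  intros Hf HD; destruct (smooth_ex_derive D f t x u Hf HD) as (? & ? & ?).
  repeat split; apply Derive_correct; assumption.
Qed.

Lemma determining_of_A_max ks l t x p : all_vanish I X U Q ks ->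
  D t x (p 0%nat 0%nat) ->
  eval Q (prune ks (d_jets l (determining (beta t) (Derive beta t)))) t x p = 0.
Proof.
  intros Hk HD; apply (determining_jets I X U oI oX oU Q A_max_smooth); trivial.
  intros y q Hq.
  apply (proj1 (A_max_determining I X U oI oX oU Q A_max_smooth
                  (Eqn I beta) eq_refl beta_derivable) HQ); assumption.
Qed.

(** Jets with prescribed [u] and [u_x] and zeros elsewhere. The values 0 and 1 of [u_x] separate
    [tau_x] from [tau_u]; all later extractions take [u_x = 0]. *)
Definition test_jet (u r : R) : jet := fun i j =>
  match i, j with O, O => u | O, 1%nat => r | _, _ => 0 end.

Definition indep_u (f : R -> R -> R -> R) : Prop :=
  forall t x u, D t x u -> f t x u = f t x u0.
Definition indep_xu (f : R -> R -> R -> R) : Prop :=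
  forall t x u, D t x u -> f t x u = f t x0 u0.

Lemma vanishes_indep_u f : smooth D f -> vanishes I X U (pd DU f) -> indep_u f.
Proof.
  intros Hf Hv t x u (Ht & Hx & Hu).
  apply (is_derive_zero_const U (fun s => f t x s)); trivial.
  intros s Hs; assert (HD : D t x s) by (repeat split; assumption).
  rewrite <- (Hv t x s HD); apply (field_derivable f t x s Hf HD).
Qed.

Lemma vanishes_indep_xu f : smooth D f ->
  vanishes I X U (pd DX f) -> vanishes I X U (pd DU f) -> indep_xu f.
Proof.
  intros Hf Hx' Hv t x u (Ht & Hx & Hu).
  rewrite (vanishes_indep_u f Hf Hv) by (repeat split; assumption).
  apply (is_derive_zero_const X (fun s => f t s u0)); trivial.
  intros s Hs; assert (HD : D t s u0) by (repeat split; assumption).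
  rewrite <- (Hx' t s u0 HD); apply (field_derivable f t s u0 Hf HD).
Qed.

Lemma indep_u_vanishes f : indep_u f -> vanishes I X U (pd DU f).
Proof.
  intros Hf t x u HD.
  rewrite (pd_ext I X U oI oX oU f (fun t x _ => f t x u0) DU Hf) by exact HD.
  exact (Derive_const _ _).
Qed.

Lemma indep_xu_vanishes f : indep_xu f ->
  vanishes I X U (pd DX f) /\ vanishes I X U (pd DU f).
Proof.
  intros Hf; split; intros t x u HD;
    rewrite (pd_ext I X U oI oX oU f (fun t _ _ => f t x0 u0) _ Hf) by exact HD;
    exact (Derive_const _ _).
Qed.

Lemma indep_u_pd_x f : indep_u f -> indep_u (pd DX f).
Proof.
  intros Hf t x u HD.
  exact (pd_ext I X U oI oX oU f (fun t x _ => f t x u0) DX Hf t x u HD).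
Qed.

Lemma indep_xu_pd_t f : indep_xu f -> indep_xu (pd DT f).
Proof.
  intros Hf t x u HD.
  exact (pd_ext I X U oI oX oU f (fun t _ _ => f t x0 u0) DT Hf t x u HD).
Qed.

Lemma tau_vanish : all_vanish I X U Q tau_kills.
Proof.
  assert (H : forall t x u r, D t x u ->
    pd_x (tau Q) t x u + r * pd_u (tau Q) t x u = 0).
  { intros t x u r HD.
    pose proof (determining_of_A_max [] [(1, 4)]%nat t x (test_jet u r)
                  (List.Forall_nil _) HD) as H.
    rewrite determining_u_txxxx in H; simpl in H.
    pose proof (beta_nonzero t (proj1 HD)) as Hb.
    apply Rmult_integral in H; destruct H; lra. }
  repeat constructor; intros t x u HD;
    pose proof (H t x u 0 HD); pose proof (H t x u 1 HD); simpl; lra.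
Qed.

Lemma xi_u_vanish : vanishes I X U (pd DU (xi Q)).
Proof.
  intros t x u HD.
  pose proof (determining_of_A_max _ [(0, 1); (0, 5)]%nat t x (test_jet u 0)
                tau_vanish HD) as H.
  rewrite determining_u_x_u_xxxxx in H; simpl in H |- *.
  pose proof (beta_nonzero t (proj1 HD)) as Hb.
  apply Rmult_integral in H; destruct H; lra.
Qed.

Lemma tau_indep : indep_xu (tau Q).
Proof.
  pose proof tau_vanish as H; inversion_clear H as [|? ? H1 H'].
  inversion_clear H' as [|? ? H2 _].
  apply vanishes_indep_xu; [exact (proj1 A_max_smooth) | exact H1 | exact H2].
Qed.

Lemma xi_x_equation t x u : D t x u ->
  tau Q t x u * Derive beta t + beta t * pd_t (tau Q) t x u
  = 5 * beta t * pd_x (xi Q) t x u.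
Proof.
  intros HD.
  assert (Hk : all_vanish I X U Q (tau_kills ++ [(Xi, [DU])])).
  { apply Forall_app; split; [exact tau_vanish|].
    repeat constructor; exact xi_u_vanish. }
  pose proof (determining_of_A_max _ [(0, 5)]%nat t x (test_jet u 0) Hk HD) as H.
  rewrite determining_u_xxxxx in H; simpl in H; lra.
Qed.

(** [xi_x_equation] can be solved for [xi_x] since beta is nonzero, and everything else in it
    depends on [t] only. *)
Lemma xi_x_indep : indep_xu (pd DX (xi Q)).
Proof.
  intros t x u HD; assert (H0 : D t x0 u0) by (split; [apply HD|split]; assumption).
  pose proof (xi_x_equation t x u HD) as H; pose proof (xi_x_equation t x0 u0 H0) as H'.
  rewrite (tau_indep t x u HD) in H.
  pose proof (indep_xu_pd_t _ tau_indep t x u HD) as Ht; simpl in Ht.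
  rewrite Ht in H; simpl.
  apply (Rmult_eq_reg_l (5 * beta t)); [lra|].
  pose proof (beta_nonzero t (proj1 HD)); lra.
Qed.

Lemma xi_vanish : all_vanish I X U Q (tau_kills ++ xi_kills).
Proof.
  destruct (indep_xu_vanishes _ xi_x_indep).
  apply Forall_app; split; [exact tau_vanish|].
  repeat constructor; [exact xi_u_vanish | assumption | assumption].
Qed.

Lemma eta_uu_vanish : vanishes I X U (pd DU (pd DU (eta Q))).
Proof.
  intros t x u HD.
  pose proof (determining_of_A_max _ [(0, 2); (0, 3)]%nat t x (test_jet u 0)
                xi_vanish HD) as H.
  rewrite determining_u_xx_u_xxx in H; simpl in H |- *.
  pose proof (beta_nonzero t (proj1 HD)) as Hb.
  apply Rmult_integral in H; destruct H; lra.
Qed.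

Lemma smooth_eta : smooth D (eta Q).
Proof. exact (proj2 (proj2 A_max_smooth)). Qed.

(** The coefficient of [u_xxxx] contains the mixed derivative in both orders, four times and once.
    Since [eta_uu = 0], [eta] is affine in [u], and both orders equal the [x]-derivative of its
    slope. *)
Lemma eta_mixed t x u : D t x u ->
  pd DX (pd DU (eta Q)) t x u = pd DU (pd DX (eta Q)) t x u.
Proof.
  intros HD.
  assert (HDU : indep_u (pd DU (eta Q))).
  { apply vanishes_indep_u; [apply smooth_pd, smooth_eta | exact eta_uu_vanish]. }
  assert (Haff : forall t x u, D t x u ->
    eta Q t x u = eta Q t x u0 + (u - u0) * pd DU (eta Q) t x u0).
  { intros s y v HDs.
    destruct (is_derive_eq_up_to_const U (fun r => eta Q s y r)
                (fun r => (r - u0) * pd DU (eta Q) s y u0)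
                (fun r => pd DU (eta Q) s y u0) HU) as (c & Hc).
    - intros r Hr; assert (HDr : D s y r).
      { destruct HDs as (? & ? & ?); repeat split; assumption. }
      rewrite <- (HDU s y r HDr); apply field_derivable; [exact smooth_eta | exact HDr].
    - intros r _; auto_derive; [trivial | exact (Rmult_1_l _)].
    - pose proof (Hc u0 Hu0) as H0; pose proof (Hc v (proj2 (proj2 HDs))) as Hv.
      simpl in H0, Hv |- *; lra. }
  assert (Hx : forall t x u, D t x u -> pd DX (eta Q) t x u
    = pd DX (eta Q) t x u0 + (u - u0) * pd DX (pd DU (eta Q)) t x u0).
  { intros s y v HDs.
    rewrite (pd_ext I X U oI oX oU _ _ DX Haff s y v HDs).
    assert (H0 : D s y u0) by (destruct HDs as (? & ? & ?); repeat split; assumption).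
    apply is_derive_unique.
    apply @is_derive_plus.
    - exact (proj1 (proj2 (field_derivable (eta Q) s y u0 smooth_eta H0))).
    - apply is_derive_scal.
      exact (proj1 (proj2 (field_derivable (pd DU (eta Q)) s y u0
               (smooth_pd _ _ DU smooth_eta) H0))). }
  rewrite (pd_ext I X U oI oX oU _ _ DU Hx t x u HD).
  rewrite (indep_u_pd_x _ HDU t x u HD); symmetry.
  apply is_derive_unique; auto_derive; [trivial | exact (Rmult_1_l _)].
Qed.

Lemma eta_vanish :
  all_vanish I X U Q (tau_kills ++ xi_kills ++ (Eta, [DU; DU]) :: eta_kills).
Proof.
  assert (Huu : all_vanish I X U Q (tau_kills ++ xi_kills ++ [(Eta, [DU; DU])])).
  { rewrite app_assoc; apply Forall_app; split; [exact xi_vanish|].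
    repeat constructor; exact eta_uu_vanish. }
  assert (Hxu : vanishes I X U (pd DX (pd DU (eta Q)))).
  { intros t x u HD.
    pose proof (determining_of_A_max _ [(0, 4)]%nat t x (test_jet u 0) Huu HD) as H.
    rewrite determining_u_xxxx in H; simpl in H |- *.
    pose proof (eta_mixed t x u HD) as Hm; simpl in Hm; rewrite <- Hm in H.
    pose proof (beta_nonzero t (proj1 HD)) as Hb.
    apply Rmult_integral in H; destruct H; lra. }
  assert (H1 : vanishes I X U (pd DU (pd DX (eta Q)))).
  { intros t x u HD; rewrite <- eta_mixed; auto. }
  assert (i1 : indep_u (pd DX (eta Q))).
  { apply vanishes_indep_u; [apply smooth_pd, smooth_eta | exact H1]. }
  pose proof (indep_u_pd_x _ i1) as i2; pose proof (indep_u_pd_x _ i2) as i3.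
  pose proof (indep_u_pd_x _ i3) as i4.
  change (tau_kills ++ xi_kills ++ (Eta, [DU; DU]) :: eta_kills)
    with ((tau_kills ++ xi_kills ++ [(Eta, [DU; DU])]) ++ eta_kills).
  apply Forall_app; split; [exact Huu|].
  repeat constructor; [exact Hxu | exact H1 | | |];
    apply indep_u_vanishes; assumption.
Qed.

Lemma eta_formula t x u : D t x u ->
  eta Q t x u = pd_t (xi Q) t x u + u * (pd_x (xi Q) t x u - pd_t (tau Q) t x u).
Proof.
  intros HD.
  pose proof (determining_of_A_max _ [(0, 1)]%nat t x (test_jet u 0) eta_vanish HD) as H.
  rewrite determining_u_x in H; simpl in H; lra.
Qed.

Lemma eta_evolution t x u : D t x u ->
  pd_t (eta Q) t x u + u * pd_x (eta Q) t x u
  + beta t * pd_x (pd_x (pd_x (pd_x (pd_x (eta Q))))) t x u = 0.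
Proof.
  intros HD.
  pose proof (determining_of_A_max _ [] t x (test_jet u 0) eta_vanish HD) as H.
  rewrite determining_full in H; simpl in H; lra.
Qed.

Lemma xi_affine t x u : D t x u ->
  xi Q t x u = pd_x (xi Q) t x0 u0 * x
               + (xi Q t x0 u0 - x0 * pd_x (xi Q) t x0 u0).
Proof.
  intros HD; pose proof (proj1 (proj2 A_max_smooth)) as Hs.
  rewrite (vanishes_indep_u _ Hs xi_u_vanish t x u HD).
  destruct (is_derive_eq_up_to_const X (fun r => xi Q t r u0)
              (fun r => pd_x (xi Q) t x0 u0 * r)
              (fun r => pd_x (xi Q) t x0 u0) HX) as (c & Hc).
  - intros r Hr; assert (HDr : D t r u0).
    { destruct HD as (? & ? & ?); repeat split; assumption. }
    pose proof (xi_x_indep t r u0 HDr) as Hr'; simpl in Hr'.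
    rewrite <- Hr'.
    exact (proj1 (proj2 (field_derivable (xi Q) t r u0 Hs HDr))).
  - intros r _; auto_derive; [trivial | exact (Rmult_1_r _)].
  - pose proof (Hc x0 Hx0); pose proof (Hc x (proj1 (proj2 HD))); simpl in *; lra.
Qed.

Lemma A_max_forward : exists a b c k n1 n0 : R,
  vf_eq_on D Q (symmetry_field a b c k n1 n0) /\
  classifying I beta a b c (5 * k - 5 / 2 * b).
Proof.
  destruct A_max_smooth as (sT & sX & sE).
  set (T := fun t => tau Q t x0 u0).
  set (T1 := fun t => pd DT (tau Q) t x0 u0).
  set (T2 := fun t => pd DT (pd DT (tau Q)) t x0 u0).
  set (m := fun t => pd DX (xi Q) t x0 u0).
  set (m1 := fun t => pd DT (pd DX (xi Q)) t x0 u0).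
  set (m2 := fun t => pd DT (pd DT (pd DX (xi Q))) t x0 u0).
  (* [N] is the constant term of [xi = m x + N]. It is expressed through [x0] because [0] need not
     lie in [X]. *)
  set (N := fun t => xi Q t x0 u0 - x0 * m t).
  set (N1 := fun t => pd DT (xi Q) t x0 u0 - x0 * m1 t).
  set (N2 := fun t => pd DT (pd DT (xi Q)) t x0 u0 - x0 * m2 t).
  assert (D0 : forall t, I t -> D t x0 u0) by (repeat split; assumption).
  assert (dt : forall f t, smooth D f -> I t ->
    is_derive (fun s => f s x0 u0) t (pd DT f t x0 u0)).
  { intros f t Hf Ht; apply (field_derivable f t x0 u0 Hf (D0 t Ht)). }
  assert (smooth2 : forall f d, smooth D f -> smooth D (pd d f)).
  { intros; apply smooth_pd; assumption. }
  assert (dT : forall t, I t -> is_derive T t (T1 t)) by (unfold T, T1; auto).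
  assert (dT1 : forall t, I t -> is_derive T1 t (T2 t)) by (unfold T1, T2; auto).
  assert (dm : forall t, I t -> is_derive m t (m1 t)) by (unfold m, m1; auto).
  assert (dm1 : forall t, I t -> is_derive m1 t (m2 t)) by (unfold m1, m2; auto).
  assert (dN : forall t, I t -> is_derive N t (N1 t)).
  { intros t Ht; apply @is_derive_minus; [auto|].
    apply is_derive_scal; auto. }
  assert (dN1 : forall t, I t -> is_derive N1 t (N2 t)).
  { intros t Ht; apply @is_derive_minus; [auto|].
    apply is_derive_scal; auto. }
  assert (Hxi : forall t x u, D t x u -> xi Q t x u = m t * x + N t)
    by exact xi_affine.
  assert (Heta : forall t x u, D t x u ->
    eta Q t x u = m1 t * x + N1 t + u * (m t - T1 t)).
  { intros t x u HD; rewrite eta_formula by exact HD.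
    pose proof (pd_ext I X U oI oX oU _ _ DT Hxi t x u HD) as H1; simpl in H1.
    rewrite H1; clear H1; pose proof (xi_x_indep t x u HD) as H2; simpl in H2.
    pose proof (indep_xu_pd_t _ tau_indep t x u HD) as H3; simpl in H3.
    rewrite H2, H3; f_equal; apply is_derive_unique.
    apply @is_derive_plus; [|apply dN, HD].
    replace (m1 t * x) with (x * m1 t) by ring.
    apply (is_derive_ext (fun s => x * m s)); [intros; apply Rmult_comm|].
    apply is_derive_scal, dm, HD. }
  assert (Hetax : forall t x u, D t x u -> pd DX (eta Q) t x u = m1 t).
  { intros t x u HD; rewrite (pd_ext I X U oI oX oU _ _ DX Heta t x u HD).
    apply is_derive_unique; auto_derive; [trivial | exact (Rmult_1_r _)]. }
  assert (Hetax5 : vanishes I X U (pds [DX; DX; DX; DX; DX] (eta Q))).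
  { apply (vanishes_pds I X U oI oX oU _ [DX; DX; DX] [DX; DX]).
    apply (indep_xu_vanishes (pd DX (eta Q))).
    intros t x u HD; rewrite !Hetax; trivial; apply D0, HD. }
  assert (Hetat : forall t x u, D t x u ->
    pd DT (eta Q) t x u = m2 t * x + N2 t + u * (m1 t - T2 t)).
  { intros t x u HD; rewrite (pd_ext I X U oI oX oU _ _ DT Heta t x u HD).
    pose proof (dm t (proj1 HD)); pose proof (dm1 t (proj1 HD)).
    pose proof (dN1 t (proj1 HD)); pose proof (dT1 t (proj1 HD)).
    apply is_derive_unique.
    apply @is_derive_plus; [apply @is_derive_plus; [|assumption]|].
    - replace (m2 t * x) with (x * m2 t) by ring.
      apply (is_derive_ext (fun s => x * m1 s)); [intros; apply Rmult_comm|].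
      apply is_derive_scal; assumption.
    - apply is_derive_scal, @is_derive_minus; assumption. }
  (* With [eta] known, the evolution equation is affine in [x] and in [u], which vary independently;
     its coefficients give [xi_x] affine in [t] and [tau_tt = 2 xi_xt]. *)
  assert (Hcoef : forall t, I t ->
    m2 t = 0 /\ N2 t = 0 /\ T2 t = 2 * m1 t).
  { intros t Ht.
    assert (He : forall x u, X x -> U u ->
      m2 t * x + N2 t + u * (2 * m1 t - T2 t) = 0).
    { intros x u Hx Hu; assert (HD : D t x u) by (repeat split; assumption).
      pose proof (eta_evolution t x u HD) as H.
      pose proof (Hetax5 t x u HD) as H5; simpl in H5; rewrite H5 in H.
      pose proof (Hetat t x u HD) as Ht'; pose proof (Hetax t x u HD) as Hx'.
      simpl in Ht', Hx'; rewrite Ht', Hx' in H; lra. }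
    assert (HT : 2 * m1 t - T2 t = 0).
    { apply (affine_vanishes U _ (m2 t * x0 + N2 t) HU).
      intros u Hu; pose proof (He x0 u Hx0 Hu); lra. }
    destruct (affine_vanishes X (m2 t) (N2 t) HX) as (? & ?); [|lra].
    intros x Hx; pose proof (He x u0 Hx Hu0) as H; rewrite HT in H; lra. }
  destruct (is_derive_eq_up_to_const I m1 (fun _ => 0) (fun _ => 0) HI) as (a & Ha).
  { intros t Ht; rewrite <- (proj1 (Hcoef t Ht)); auto. }
  { intros; apply @is_derive_const. }
  destruct (is_derive_eq_up_to_const I N1 (fun _ => 0) (fun _ => 0) HI) as (n1 & Hn1).
  { intros t Ht; rewrite <- (proj1 (proj2 (Hcoef t Ht))); auto. }
  { intros; apply @is_derive_const. }
  destruct (is_derive_eq_up_to_const I m (fun t => a * t) m1 HI) as (k & Hk); auto.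
  { intros t Ht; rewrite Ha by assumption; auto_derive; [trivial | ring]. }
  destruct (is_derive_eq_up_to_const I N (fun t => n1 * t) N1 HI) as (n0 & Hn0); auto.
  { intros t Ht; rewrite Hn1 by assumption; auto_derive; [trivial | ring]. }
  destruct (is_derive_eq_up_to_const I T1 (fun t => 2 * a * t) T2 HI) as (b & Hb); auto.
  { intros t Ht; rewrite (proj2 (proj2 (Hcoef t Ht))), Ha by assumption.
    auto_derive; [trivial | ring]. }
  destruct (is_derive_eq_up_to_const I T (fun t => a * t ^ 2 + b * t) T1 HI)
    as (c & Hc); auto.
  { intros t Ht; rewrite Hb by assumption; auto_derive; [trivial | ring]. }
  exists a, b, c, k, n1, n0; split.
  - intros t x u HD; pose proof (proj1 HD) as Ht; simpl.
    rewrite (tau_indep t x u HD), Hxi, Heta by exact HD.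
    fold (T t); rewrite Hc, Hk, Hn0, Ha, Hn1, Hb by exact Ht.
    repeat split; ring.
  - intros t Ht; pose proof (xi_x_equation t x0 u0 (D0 t Ht)) as H.
    change (T t * Derive beta t + beta t * T1 t = 5 * beta t * m t) in H.
    rewrite Hc, Hb, Hk in H by exact Ht; lra.
Qed.
End Forward.

(** * Sufficiency of the classifying condition *)

Section Backward.
Variables (Q : vfield) (a b c k n1 n0 : R).
Hypothesis HQ : vf_eq_on D Q (symmetry_field a b c k n1 n0).
Hypothesis Hclass : classifying I beta a b c (5 * k - 5 / 2 * b).

Lemma pd_of_eq f g dg d : (forall t x u, D t x u -> f t x u = g t x u) ->
  (forall t x u, pd d g t x u = dg t x u) ->
  forall t x u, D t x u -> pd d f t x u = dg t x u.
Proof.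
  intros Hf Hg t x u HD.
  rewrite (pd_ext I X U oI oX oU f g d Hf t x u HD); apply Hg.
Qed.

(** Every derivative on the full kill list vanishes for a symmetry field, so the pruned form
    [determining_full] applies again. Its coefficient of [u_xxxxx] vanishes by the classifying
    condition, the other two groups identically. *)
Lemma A_max_backward : smooth_vf D Q -> A_max X U (Eqn I beta) Q.
Proof.
  intros HS.
  apply (A_max_determining I X U oI oX oU Q HS (Eqn I beta) eq_refl beta_derivable).
  intros t x p HD; simpl Defs.beta.
  assert (Ht : forall t x u, D t x u -> tau Q t x u = a * t ^ 2 + b * t + c)
    by (intros; apply HQ; assumption).
  assert (Hx : forall t x u, D t x u -> xi Q t x u = (a * t + k) * x + (n1 * t + n0))
    by (intros; apply HQ; assumption).
  assert (He : forall t x u, D t x u ->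
    eta Q t x u = (k - b + - a * t) * u + (a * x + n1))
    by (intros; apply HQ; assumption).
  assert (Htt := pd_of_eq _ _ (fun t _ _ => 2 * a * t + b) DT Ht).
  assert (Htx := pd_of_eq _ _ (fun _ _ _ => 0) DX Ht).
  assert (Htu := pd_of_eq _ _ (fun _ _ _ => 0) DU Ht).
  assert (Hxt := pd_of_eq _ _ (fun t x _ => a * x + n1) DT Hx).
  assert (Hxx := pd_of_eq _ _ (fun t x _ => a * t + k) DX Hx).
  assert (Hxu := pd_of_eq _ _ (fun _ _ _ => 0) DU Hx).
  assert (Het := pd_of_eq _ _ (fun t x u => - a * u) DT He).
  assert (Hex := pd_of_eq _ _ (fun t x u => a) DX He).
  assert (Heu := pd_of_eq _ _ (fun t x u => k - b + - a * t) DU He).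
  assert (Hder : forall (f : R -> R) s l, is_derive f s l -> Derive f s = l)
    by (intros; apply is_derive_unique; assumption).
  lapply Htt; clear Htt; [intros Htt|intros; apply Hder; auto_derive; [trivial|ring]].
  lapply Htx; clear Htx; [intros Htx|intros; apply Hder; auto_derive; [trivial|ring]].
  lapply Htu; clear Htu; [intros Htu|intros; apply Hder; auto_derive; [trivial|ring]].
  lapply Hxt; clear Hxt; [intros Hxt|intros; apply Hder; auto_derive; [trivial|ring]].
  lapply Hxx; clear Hxx; [intros Hxx|intros; apply Hder; auto_derive; [trivial|ring]].
  lapply Hxu; clear Hxu; [intros Hxu|intros; apply Hder; auto_derive; [trivial|ring]].
  lapply Het; clear Het; [intros Het|intros; apply Hder; auto_derive; [trivial|ring]].
  lapply Hex; clear Hex; [intros Hex|intros; apply Hder; auto_derive; [trivial|ring]].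
  lapply Heu; clear Heu; [intros Heu|intros; apply Hder; auto_derive; [trivial|ring]].
  assert (Hxxx := pd_of_eq _ _ (fun _ _ _ => 0) DX Hxx (fun t _ _ => Derive_const _ _)).
  assert (Hxxu := pd_of_eq _ _ (fun _ _ _ => 0) DU Hxx (fun t _ _ => Derive_const _ _)).
  assert (Hexx := pd_of_eq _ _ (fun _ _ _ => 0) DX Hex (fun t _ _ => Derive_const _ _)).
  assert (Hexu := pd_of_eq _ _ (fun _ _ _ => 0) DU Hex (fun t _ _ => Derive_const _ _)).
  assert (Heux := pd_of_eq _ _ (fun _ _ _ => 0) DX Heu (fun t _ _ => Derive_const _ _)).
  assert (Heuu := pd_of_eq _ _ (fun _ _ _ => 0) DU Heu (fun t _ _ => Derive_const _ _)).
  assert (Hk : all_vanish I X U Q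
    (tau_kills ++ xi_kills ++ (Eta, [DU; DU]) :: eta_kills)).
  { pose proof (fun w => vanishes_pds I X U oI oX oU (eta Q) w [DX; DX] Hexx) as Hw.
    repeat constructor; try assumption;
      [exact (Hw [DU]) | exact (Hw [DU; DX]) | exact (Hw [DU; DX; DX])]. }
  assert (H5 := vanishes_pds I X U oI oX oU (eta Q) [DX; DX; DX] [DX; DX] Hexx
                  _ _ _ HD).
  change (determining (beta t) (Derive beta t))
    with (d_jets [] (determining (beta t) (Derive beta t))).
  rewrite <- (eval_prune I X U oI oX oU Q _ _ _ _ _ Hk HD), determining_full.
  simpl in *; rewrite H5, Htt, Hxt, Hxx, Het, Hex, Ht, He by exact HD.
  pose proof (Hclass t (proj1 HD)) as H; simpl in H; clear - H.
  match goal with |- p _ _ * ?A + _ + _ = 0 => replace A with 0 by lra end; ring.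
Qed.
End Backward.

(** * Smoothness of polynomial fields *)

Lemma box_open : open (fun q : R * R * R => D (fst (fst q)) (snd (fst q)) (snd q)).
Proof.
  apply open_and; [|apply open_and].
  - apply (open_comp (fun q : R * R * R => fst (fst q)) I); [|exact oI].
    intros q _; apply (continuous_comp fst fst); apply continuous_fst.
  - apply (open_comp (fun q : R * R * R => snd (fst q)) X); [|exact oX].
    intros q _; apply (continuous_comp fst snd);
      [apply continuous_fst | apply continuous_snd].
  - apply (open_comp (fun q : R * R * R => snd q) U); [|exact oU].
    intros q _; apply continuous_snd.
Qed.

Lemma class_C_ext n f g : (forall t x u, D t x u -> f t x u = g t x u) ->
  class_C n D f -> class_C n D g.
Proof.
  revert f g; induction n as [|n IH]; intros f g Hfg; simpl;
    intros (Hc & H); split.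
  1, 3: intros t x u HD;
    apply (continuous_ext_loc _
             (fun q : R * R * R => f (fst (fst q)) (snd (fst q)) (snd q)));
    [apply (filter_imp (fun q : R * R * R => D (fst (fst q)) (snd (fst q)) (snd q)));
     [intros q Hq; apply Hfg, Hq | apply (box_open (t, x, u) HD)] | auto].
  - trivial.
  - destruct H as (Hd & Ht & Hx & Hu); repeat split.
    1, 2, 3: destruct H as (Ht' & Hx' & Hu'); destruct (Hd t x u) as (d1 & d2 & d3);
      [repeat split; assumption|].
    + apply (ex_derive_ext_loc (fun s => f s x u)); [|exact d1].
      apply (filter_imp I); [|apply oI, Ht'].
      intros; apply Hfg; repeat split; assumption.
    + apply (ex_derive_ext_loc (fun s => f t s u)); [|exact d2].
      apply (filter_imp X); [|apply oX, Hx'].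
      intros; apply Hfg; repeat split; assumption.
    + apply (ex_derive_ext_loc (fun s => f t x s)); [|exact d3].
      apply (filter_imp U); [|apply oU, Hu'].
      intros; apply Hfg; repeat split; assumption.
    + apply (IH (pd_t f)); [exact (pd_ext I X U oI oX oU f g DT Hfg)|exact Ht].
    + apply (IH (pd_x f)); [exact (pd_ext I X U oI oX oU f g DX Hfg)|exact Hx].
    + apply (IH (pd_u f)); [exact (pd_ext I X U oI oX oU f g DU Hfg)|exact Hu].
Qed.

Lemma smooth_ext f g : (forall t x u, D t x u -> f t x u = g t x u) ->
  smooth D f -> smooth D g.
Proof. intros Hfg Hf n; exact (class_C_ext n f g Hfg (Hf n)). Qed.

Lemma class_C_const n r : class_C n D (fun _ _ _ => r).
Proof.
  revert r; induction n as [|n IH]; intros r; simpl; split.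
  1, 3: intros; apply continuous_const.
  - trivial.
  - repeat split; try apply ex_derive_const;
      apply (class_C_ext n (fun _ _ _ => 0)); trivial;
      intros; symmetry; exact (Derive_const r _).
Qed.

(** The product rule at order [n + 1] multiplies derivatives of one factor by the other factor
    itself, which must therefore be available at order [n]. *)
Lemma class_C_pred n f : class_C (S n) D f -> class_C n D f.
Proof.
  revert f; induction n as [|n IH]; intros f (Hc & Hd & Ht & Hx & Hu);
    split; trivial; repeat split; try apply (Hd t x u); auto.
Qed.

Lemma class_C_plus n f g : class_C n D f -> class_C n D g ->
  class_C n D (fun t x u => f t x u + g t x u).
Proof.
  revert f g; induction n as [|n IH]; intros f g (fc & Hf) (gc & Hg); split; trivial.
  1, 2: intros; apply (@continuous_plus _ R_AbsRing R_NormedModule); auto.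
  destruct Hf as (fd & ft & fx & fu), Hg as (gd & gt & gx & gu); repeat split.
  1, 2, 3: apply (@ex_derive_plus R_AbsRing R_NormedModule);
    [apply (fd t x u) | apply (gd t x u)]; assumption.
  - refine (class_C_ext n (fun t x u => pd_t f t x u + pd_t g t x u) _ _
              (IH _ _ ft gt)).
    intros t x u HD; symmetry.
    exact (Derive_plus (fun s => f s x u) (fun s => g s x u) t
             (proj1 (fd t x u HD)) (proj1 (gd t x u HD))).
  - refine (class_C_ext n (fun t x u => pd_x f t x u + pd_x g t x u) _ _
              (IH _ _ fx gx)).
    intros t x u HD; symmetry.
    exact (Derive_plus (fun s => f t s u) (fun s => g t s u) x
             (proj1 (proj2 (fd t x u HD))) (proj1 (proj2 (gd t x u HD)))).
  - refine (class_C_ext n (fun t x u => pd_u f t x u + pd_u g t x u) _ _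
              (IH _ _ fu gu)).
    intros t x u HD; symmetry.
    exact (Derive_plus (fun s => f t x s) (fun s => g t x s) u
             (proj2 (proj2 (fd t x u HD))) (proj2 (proj2 (gd t x u HD)))).
Qed.

Lemma class_C_mult n f g : class_C n D f -> class_C n D g ->
  class_C n D (fun t x u => f t x u * g t x u).
Proof.
  revert f g; induction n as [|n IH]; intros f g Hf Hg.
  - split; trivial; intros; apply (@continuous_mult _ R_AbsRing);
      [apply Hf | apply Hg]; assumption.
  - pose proof (class_C_pred n f Hf) as Hf'; pose proof (class_C_pred n g Hg) as Hg'.
    destruct Hf as (fc & fd & ft & fx & fu), Hg as (gc & gd & gt & gx & gu).
    split; [intros; apply (@continuous_mult _ R_AbsRing); auto|]; repeat split.
    1, 2, 3: apply ex_derive_mult; [apply (fd t x u) | apply (gd t x u)]; assumption.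
    + refine (class_C_ext n
                (fun t x u => pd_t f t x u * g t x u + f t x u * pd_t g t x u) _ _
                (class_C_plus _ _ _ (IH _ _ ft Hg') (IH _ _ Hf' gt))).
      intros t x u HD; symmetry.
      exact (Derive_mult (fun s => f s x u) (fun s => g s x u) t
               (proj1 (fd t x u HD)) (proj1 (gd t x u HD))).
    + refine (class_C_ext n
                (fun t x u => pd_x f t x u * g t x u + f t x u * pd_x g t x u) _ _
                (class_C_plus _ _ _ (IH _ _ fx Hg') (IH _ _ Hf' gx))).
      intros t x u HD; symmetry.
      exact (Derive_mult (fun s => f t s u) (fun s => g t s u) x
               (proj1 (proj2 (fd t x u HD))) (proj1 (proj2 (gd t x u HD)))).
    + refine (class_C_ext n
                (fun t x u => pd_u f t x u * g t x u + f t x u * pd_u g t x u) _ _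
                (class_C_plus _ _ _ (IH _ _ fu Hg') (IH _ _ Hf' gu))).
      intros t x u HD; symmetry.
      exact (Derive_mult (fun s => f t x s) (fun s => g t x s) u
               (proj2 (proj2 (fd t x u HD))) (proj2 (proj2 (gd t x u HD)))).
Qed.

Lemma smooth_coordinates : smooth D (fun t _ _ => t) /\ smooth D (fun _ x _ => x) /\
  smooth D (fun _ _ u => u).
Proof.
  repeat split; intros [|n]; (split; [intros t x u _|]); trivial.
  1, 2: apply (continuous_comp fst fst); apply continuous_fst.
  2, 3: apply (continuous_comp fst snd); [apply continuous_fst | apply continuous_snd].
  3, 4: apply continuous_snd.
  all: split; [intros; repeat split; auto_derive; trivial|].
  all: repeat split; eapply class_C_ext;
    try (intros t x u _; symmetry; exact (Derive_id _));
    try (intros t x u _; symmetry; exact (Derive_const _ _));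
    apply class_C_const.
Qed.

Lemma smooth_symmetry_field Q a b c k n1 n0 :
  vf_eq_on D Q (symmetry_field a b c k n1 n0) -> smooth_vf D Q.
Proof.
  intros HQ; destruct smooth_coordinates as (ct & cx & cu).
  repeat split; (eapply smooth_ext; [intros t x u HD; symmetry; apply HQ, HD|]);
    intros n; simpl;
    repeat first [apply ct | apply cx | apply cu | apply class_C_const
                 | apply class_C_plus | apply class_C_mult].
Qed.
End Symmetries.

Lemma A_max_iff (I X U : R -> Prop) beta Q : is_open_interval I ->
  is_open_interval X -> is_open_interval U ->
  (forall t, I t -> ex_derive beta t) -> (forall t, I t -> beta t <> 0) ->
  A_max X U (Eqn I beta) Q <->
  exists a b c k n1 n0 : R,
    vf_eq_on (box I X U) Q (symmetry_field a b c k n1 n0) /\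
    classifying I beta a b c (5 * k - 5 / 2 * b).
Proof.
  intros HI HX HU Hd Hn; split.
  - intros HQ.
    destruct (open_interval_two_points X HX) as (x0 & _ & Hx0 & _).
    destruct (open_interval_two_points U HU) as (u0 & _ & Hu0 & _).
    exact (A_max_forward I X U HI HX HU beta Hd Hn Q HQ x0 u0 Hx0 Hu0).
  - intros (a & b & c & k & n1 & n0 & HQ & Hc).
    apply (A_max_backward I X U HI HX HU beta Hd Q a b c k n1 n0 HQ Hc).
    exact (smooth_symmetry_field I X U HI HX HU Q a b c k n1 n0 HQ).
Qed.

(** * The kernel and the listed cases *)

Lemma A_ker_iff I X U Q :
  A_ker I X U Q <->
  exists n1 n0 : R, vf_eq_on (box I X U) Q (symmetry_field 0 0 0 0 n1 n0).
Proof.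
  unfold A_ker, in_span; split.
  - intros (cs & Hl & H).
    destruct cs as [|n0 [|n1 [|]]]; try discriminate Hl.
    exists n1, n0; intros t x u HD; destruct (H t x u HD) as (-> & -> & ->).
    simpl; repeat split; ring.
  - intros (n1 & n0 & H); exists [n0; n1]; split; [reflexivity|].
    intros t x u HD; destruct (H t x u HD) as (-> & -> & ->).
    simpl; repeat split; ring.
Qed.

(** Finite differences at four equally spaced points: the third difference is [6 h^3 p], after which
    the second and first differences isolate [q] and [r]. *)
Lemma cubic_vanishes J p q r s : is_open_interval J ->
  (forall t, J t -> p * t ^ 3 + q * t ^ 2 + r * t + s = 0) ->
  p = 0 /\ q = 0 /\ r = 0 /\ s = 0.
Proof.
  intros HJ H; destruct (open_interval_two_points J HJ) as (t & t' & Ht & Ht' & Hlt).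
  set (h := (t' - t) / 3).
  assert (H0 := H t Ht); assert (H3 := H t' Ht').
  assert (H1 : p * (t + h) ^ 3 + q * (t + h) ^ 2 + r * (t + h) + s = 0).
  { apply H, (open_interval_convex J t t'); trivial; unfold h; lra. }
  assert (H2 : p * (t + 2 * h) ^ 3 + q * (t + 2 * h) ^ 2 + r * (t + 2 * h) + s = 0).
  { apply H, (open_interval_convex J t t'); trivial; unfold h; lra. }
  replace t' with (t + 3 * h) in H3 by (unfold h; field).
  assert (Hh : h <> 0) by (unfold h; lra).
  assert (Hp : p * (6 * h ^ 3) = 0) by lra.
  apply Rmult_integral in Hp; destruct Hp as [->|Hp].
  2: { apply (Rmult_integral 6) in Hp; destruct Hp as [|Hp]; [lra|].
       apply pow_nonzero with (n := 3%nat) in Hh; contradiction. }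
  assert (Hq : q * (2 * h ^ 2) = 0) by lra.
  apply Rmult_integral in Hq; destruct Hq as [->|Hq].
  2: { apply (Rmult_integral 2) in Hq; destruct Hq as [|Hq]; [lra|].
       apply pow_nonzero with (n := 2%nat) in Hh; contradiction. }
  assert (Hr : r * h = 0) by lra.
  apply Rmult_integral in Hr; destruct Hr as [->|]; [lra | contradiction].
Qed.

(** The solution space of the classifying condition: a line in the first three cases, a plane for
    the constant. *)
Definition case_solution (cs : case) (a b c kappa : R) : Prop :=
  match cs with
  | Power rho => a = 0 /\ c = 0 /\ kappa = b * (rho - 3 / 2)
  | Expon => a = 0 /\ b = 0 /\ kappa = c
  | Arctan nu => b = 0 /\ a = c /\ kappa = 5 * nu * c
  | Constant => a = 0 /\ kappa = - 3 / 2 * b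
  end.

Definition case_log_derivative (cs : case) (t : R) : R :=
  match cs with
  | Power rho => rho / t
  | Expon => 1
  | Arctan nu => (3 * t + 5 * nu) / (t ^ 2 + 1)
  | Constant => 0
  end.

Lemma case_beta_pos cs t : 0 < case_beta cs t.
Proof.
  destruct cs; simpl; try apply exp_pos; [|lra].
  apply Rmult_lt_0_compat; apply exp_pos.
Qed.

Lemma case_beta_is_derive cs t : case_dom cs t ->
  is_derive (case_beta cs) t (case_log_derivative cs t * case_beta cs t).
Proof.
  destruct cs as [rho| |nu|]; intros Ht; unfold case_beta, Rpower; simpl in *.
  - auto_derive; [assumption | field; lra].
  - auto_derive; [trivial | ring].
  - auto_derive; [nra|]; field; nra.
  - auto_derive; [trivial | ring].
Qed.

Lemma case_beta_derivable cs t : case_dom cs t -> ex_derive (case_beta cs) t.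
Proof. intros Ht; eexists; apply case_beta_is_derive, Ht. Qed.

Lemma classifying_case_iff cs I a b c kappa : subset I (case_dom cs) ->
  classifying I (case_beta cs) a b c kappa <->
  forall t, I t -> (a * t ^ 2 + b * t + c) * case_log_derivative cs t
                   = 3 / 2 * (2 * a * t + b) + kappa.
Proof.
  intros HI; split; intros H t Ht; specialize (H t Ht);
    pose proof (is_derive_unique _ _ _ (case_beta_is_derive cs t (HI t Ht))) as Hd;
    pose proof (case_beta_pos cs t) as Hp.
  - rewrite Hd in H; apply (Rmult_eq_reg_r (case_beta cs t)); lra.
  - rewrite Hd, <- H; ring.
Qed.

Lemma case_solution_classifying cs I a b c kappa : subset I (case_dom cs) ->
  case_solution cs a b c kappa -> classifying I (case_beta cs) a b c kappa.
Proof.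
  intros HI Hs; apply (classifying_case_iff cs I); [exact HI|].
  intros t Ht; apply HI in Ht; destruct cs; simpl in *.
  - destruct Hs as (-> & -> & ->); field; lra.
  - destruct Hs as (-> & -> & ->); ring.
  - destruct Hs as (-> & -> & ->); field; nra.
  - destruct Hs as (-> & ->); field.
Qed.

(** Clearing denominators leaves a polynomial identity in [t]. For powers it contains [a (rho - 3)]
    and [c rho], and the normalization keeps both factors nonzero. *)
Lemma classifying_case_solution cs I a b c kappa : case_param cs ->
  case_interval cs I -> classifying I (case_beta cs) a b c kappa ->
  case_solution cs a b c kappa.
Proof.
  intros Hp (HI & Hsub) H.
  pose proof (proj1 (classifying_case_iff cs I _ _ _ _ Hsub) H) as H'.
  clear H; destruct cs as [rho| |nu|]; simpl in *.
  - destruct (cubic_vanishes I 0 (a * (rho - 3)) (b * (rho - 3 / 2) - kappa)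
                (c * rho) HI) as (_ & Ha & Hb & Hc).
    { intros t Ht; pose proof (Hsub t Ht) as Hpos; simpl in Hpos.
      pose proof (H' t Ht) as H.
      transitivity ((a * (t * (t * 1)) + b * t + c) * (rho / t) * t
                    - (3 / 2 * (2 * a * t + b) + kappa) * t).
      - field; lra.
      - rewrite H; ring. }
    apply Rmult_integral in Ha, Hc; lra.
  - destruct (cubic_vanishes I 0 a (b - 3 * a) (c - 3 / 2 * b - kappa) HI); [|lra].
    intros t Ht; pose proof (H' t Ht); lra.
  - destruct (cubic_vanishes I 0 (5 * nu * a + 3 / 2 * b - kappa)
               (3 * c + 5 * nu * b - 3 * a) (5 * nu * c - 3 / 2 * b - kappa) HI)
      as (_ & H2 & H1 & H0).
    { intros t Ht; pose proof (H' t Ht) as H.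
      assert (H3 : (a * (t * (t * 1)) + b * t + c) * (3 * t + 5 * nu)
        = (3 / 2 * (2 * a * t + b) + kappa) * (t * (t * 1) + 1)).
      { rewrite <- H; field; nra. }
      lra. }
    (* Eliminating [kappa] gives [5 nu (a - c) + 3 b = 0], while [H1] gives [a - c = 5 nu b / 3]. *)
    assert (Hb : b * (3 + 25 / 3 * nu ^ 2) = 0) by nra.
    apply Rmult_integral in Hb; destruct Hb as [->|]; nra.
  - destruct (cubic_vanishes I 0 0 (3 * a) (3 / 2 * b + kappa) HI); [|lra].
    intros t Ht; pose proof (H' t Ht); lra.
Qed.

Lemma in_class_derivable E t : in_class E -> dom E t ->
  ex_derive (beta E) t /\ ex_derive (Derive (beta E)) t.
Proof.
  intros (_ & Hs & _) Ht; split; [exact (Hs 1%nat t Ht) | exact (Hs 2%nat t Ht)].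
Qed.

Lemma in_class_one I : is_open_interval I -> in_class (Eqn I (fun _ => 1)).
Proof.
  intros HI; split; [exact HI|split; simpl]; [|intros; lra].
  intros n t _; apply ex_derive_n_const.
Qed.

Lemma in_class_exp I : is_open_interval I -> in_class (Eqn I exp).
Proof.
  intros HI; split; [exact HI|split; simpl].
  - intros [|n] t _; [exact Logic.I|]; exists (exp t).
    apply (is_derive_ext exp); [|auto_derive; [trivial | ring]].
    intros s; symmetry; apply is_derive_n_unique, is_derive_n_exp.
  - intros t _; apply Rgt_not_eq, exp_pos.
Qed.

Lemma A_ker_subset_A_max X U E Q : is_open_interval X -> is_open_interval U ->
  in_class E -> A_ker (dom E) X U Q -> A_max X U E Q.
Proof.
  intros HX HU HE HQ; destruct HE as (HI & Hs & Hn) eqn:HE'; clear HE'.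
  apply A_ker_iff in HQ; destruct HQ as (n1 & n0 & HQ); destruct E as (I, b).
  apply A_max_iff; trivial.
  - intros t Ht; apply (in_class_derivable _ t HE Ht).
  - exists 0, 0, 0, 0, n1, n0; split; [exact HQ|].
    intros t Ht; ring.
Qed.

Lemma symmetry_field_inj I X U a b c k n1 n0 a' b' c' k' n1' n0' :
  is_open_interval I -> is_open_interval X -> is_open_interval U ->
  vf_eq_on (box I X U) (symmetry_field a b c k n1 n0)
    (symmetry_field a' b' c' k' n1' n0') ->
  a = a' /\ b = b' /\ c = c' /\ k = k' /\ n1 = n1' /\ n0 = n0'.
Proof.
  intros HI HX HU H.
  destruct (open_interval_two_points I HI) as (t0 & _ & Ht0 & _).
  destruct (open_interval_two_points X HX) as (x0 & _ & Hx0 & _).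
  destruct (open_interval_two_points U HU) as (u0 & _ & Hu0 & _).
  assert (HD : forall t x, I t -> X x -> box I X U t x u0).
  { intros; repeat split; assumption. }
  destruct (cubic_vanishes I 0 (a - a') (b - b') (c - c') HI) as (_ & Ha & Hb & Hc).
  { intros t Ht; destruct (H t x0 u0 (HD t x0 Ht Hx0)) as (H1 & _).
    simpl in H1; lra. }
  assert (a = a') as <- by lra; assert (b = b') as <- by lra.
  destruct (affine_vanishes X (k - k') ((n1 * t0 + n0) - (n1' * t0 + n0')) HX)
    as (Hk & _).
  { intros x Hx; destruct (H t0 x u0 (HD t0 x Ht0 Hx)) as (_ & H2 & _).
    simpl in H2; lra. }
  assert (k = k') as <- by lra.
  destruct (affine_vanishes I (n1 - n1') (n0 - n0') HI); [|lra].
  intros t Ht; destruct (H t x0 u0 (HD t x0 Ht Hx0)) as (_ & H2 & _).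
  simpl in H2; lra.
Qed.

Lemma vf_eq_on_trans D Q1 Q2 Q3 :
  vf_eq_on D Q1 Q2 -> vf_eq_on D Q2 Q3 -> vf_eq_on D Q1 Q3.
Proof.
  intros H H' t x u HD; destruct (H t x u HD) as (-> & -> & ->); apply H', HD.
Qed.

Lemma vf_eq_on_sym D Q1 Q2 : vf_eq_on D Q1 Q2 -> vf_eq_on D Q2 Q1.
Proof. intros H t x u HD; destruct (H t x u HD) as (-> & -> & ->); auto. Qed.

(** The two equations with beta equal to [1] and to [exp] suffice: the former gives
    [kappa = - 3/2 b], the latter [b = 0] and [kappa = c], so [c] and [k] vanish too. *)
Lemma kernel_eq_A_ker I X U Q : is_open_interval I -> is_open_interval X ->
  is_open_interval U -> kernel I X U Q <-> A_ker I X U Q.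
Proof.
  intros HI HX HU; split.
  - intros HQ.
    pose proof (HQ _ (in_class_one I HI)) as H1.
    pose proof (HQ _ (in_class_exp I HI)) as H2.
    apply A_max_iff in H1; trivial; [|intros; apply ex_derive_const].
    apply A_max_iff in H2; trivial;
      [|intros; auto_derive; trivial|intros; apply Rgt_not_eq, exp_pos].
    destruct H1 as (a & b & c & k & n1 & n0 & H1 & C1).
    destruct H2 as (a' & b' & c' & k' & n1' & n0' & H2 & C2).
    destruct (symmetry_field_inj I X U _ _ _ _ _ _ _ _ _ _ _ _ HI HX HU
      (vf_eq_on_trans _ _ _ _ (vf_eq_on_sym _ _ _ H1) H2)) as (<- & <- & <- & <- & _).
    apply (classifying_case_solution Constant I) in C1;
      [|exact Logic.I | split; [exact HI | intros ? _; exact Logic.I]].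
    apply (classifying_case_solution Expon I) in C2;
      [|exact Logic.I | split; [exact HI | intros ? _; exact Logic.I]].
    simpl in C1, C2; apply A_ker_iff; exists n1, n0.
    assert (a = 0) as -> by lra; assert (b = 0) as -> by lra.
    assert (k = 0) as -> by lra; assert (c = 0) as -> by lra; exact H1.
  - intros HQ b Hb; apply (A_ker_subset_A_max X U _ Q HX HU Hb), HQ.
Qed.

Lemma ker_basis_lin_indep I X U : is_open_interval I -> is_open_interval X ->
  is_open_interval U -> lin_indep (box I X U) ker_basis.
Proof.
  intros HI HX HU cs Hl H.
  destruct cs as [|n0 [|n1 [|]]]; try discriminate Hl.
  destruct (symmetry_field_inj I X U 0 0 0 0 n1 n0 0 0 0 0 0 0 HI HX HU)
    as (_ & _ & _ & _ & -> & ->).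
  - intros t x u HD; destruct (H t x u HD) as (H1 & H2 & H3); simpl in *.
    repeat split; lra.
  - intros r [<-|[<-|[]]]; reflexivity.
Qed.

Lemma A_ker_abelian I X U Q1 Q2 : is_open_interval I -> is_open_interval X ->
  is_open_interval U -> A_ker I X U Q1 -> A_ker I X U Q2 ->
  vf_eq_on (box I X U) (bracket Q1 Q2) vf_zero.
Proof.
  intros HI HX HU H1 H2.
  apply A_ker_iff in H1; destruct H1 as (n1 & n0 & H1).
  apply A_ker_iff in H2; destruct H2 as (m1 & m0 & H2).
  (* [xi_t] is excluded because it need not vanish; in the bracket it is multiplied by the zero
     [tau] of the other field. *)
  assert (Hact : forall Q r1 r0,
    vf_eq_on (box I X U) Q (symmetry_field 0 0 0 0 r1 r0) ->
    forall t x u, box I X U t x u ->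
    (tau Q t x u = 0 /\ xi Q t x u = r1 * t + r0 /\ eta Q t x u = r1) /\
    forall d, pd d (tau Q) t x u = 0 /\ pd d (eta Q) t x u = 0 /\
      (d <> DT -> pd d (xi Q) t x u = 0)).
  { intros Q r1 r0 HQ t x u HD; split.
    - destruct (HQ t x u HD) as (-> & -> & ->); simpl; repeat split; ring.
    - pose proof (open_interval_open I HI) as oI.
      pose proof (open_interval_open X HX) as oX.
      pose proof (open_interval_open U HU) as oU.
      intros d; repeat split.
      + rewrite (pd_ext I X U oI oX oU (tau Q) (fun _ _ _ => 0)) by
          (trivial; intros s y v HD'; rewrite (proj1 (HQ s y v HD')); simpl; ring).
        destruct d; exact (Derive_const _ _).
      + rewrite (pd_ext I X U oI oX oU (eta Q) (fun _ _ _ => r1)) by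
          (trivial; intros s y v HD'; rewrite (proj2 (proj2 (HQ s y v HD'))); simpl; ring).
        destruct d; exact (Derive_const _ _).
      + intros Hd.
        rewrite (pd_ext I X U oI oX oU (xi Q) (fun t _ _ => r1 * t + r0)) by
          (trivial; intros s y v HD'; rewrite (proj1 (proj2 (HQ s y v HD'))); simpl; ring).
        destruct d; [contradiction| |]; exact (Derive_const _ _). }
  intros t x u HD.
  destruct (Hact Q1 n1 n0 H1 t x u HD) as ((T1 & _) & P1).
  destruct (Hact Q2 m1 m0 H2 t x u HD) as ((T2 & _) & P2).
  pose proof (P1 DT) as (a1 & a2 & _); pose proof (P1 DX) as (a3 & a4 & a5).
  pose proof (P1 DU) as (a6 & a7 & a8).
  pose proof (P2 DT) as (b1 & b2 & _); pose proof (P2 DX) as (b3 & b4 & b5).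
  pose proof (P2 DU) as (b6 & b7 & b8).
  specialize (a5 ltac:(discriminate)); specialize (a8 ltac:(discriminate)).
  specialize (b5 ltac:(discriminate)); specialize (b8 ltac:(discriminate)).
  simpl in *; unfold vf_act.
  rewrite T1, T2, a1, a2, a3, a4, a5, a6, a7, a8, b1, b2, b3, b4, b5, b6, b7, b8.
  repeat split; ring.
Qed.

Lemma A_max_case cs I X U Q : is_open_interval X -> is_open_interval U ->
  case_param cs -> case_interval cs I ->
  A_max X U (Eqn I (case_beta cs)) Q <-> in_span (box I X U) (case_basis cs) Q.
Proof.
  intros HX HU Hp HI.
  rewrite A_max_iff; trivial.
  2: exact (proj1 HI).
  2: intros t Ht; apply case_beta_derivable, HI, Ht.
  2: intros t Ht; apply Rgt_not_eq, case_beta_pos.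
  split.
  - intros (a & b & c & k & n1 & n0 & HQ & HC).
    apply (classifying_case_solution cs I _ _ _ _ Hp HI) in HC.
    destruct cs as [rho| |nu|]; simpl in HC.
    + destruct HC as (-> & -> & HC).
      (* The listed field has [tau = 5 t], whence [b / 5]; [k] is then recovered from
         [kappa = 5 k - 5/2 b]. *)
      exists [n0; n1; b / 5]; split; [reflexivity|].
      apply (vf_eq_on_trans _ _ _ _ HQ); intros t x u _; simpl.
      replace k with (b * (rho + 1) / 5) by lra; repeat split; field.
    + destruct HC as (-> & -> & HC).
      exists [n0; n1; c / 5]; split; [reflexivity|].
      apply (vf_eq_on_trans _ _ _ _ HQ); intros t x u _; simpl.
      replace k with (c / 5) by lra; repeat split; field.
    + destruct HC as (-> & -> & HC).
      exists [n0; n1; c]; split; [reflexivity|].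
      apply (vf_eq_on_trans _ _ _ _ HQ); intros t x u _; simpl.
      replace k with (nu * c) by lra; repeat split; field.
    + destruct HC as (-> & HC).
      exists [n0; n1; c; b / 5]; split; [reflexivity|].
      apply (vf_eq_on_trans _ _ _ _ HQ); intros t x u _; simpl.
      replace k with (b / 5) by lra; repeat split; field.
  - intros (l & Hl & HQ).
    destruct cs as [rho| |nu|];
      destruct l as [|n0 [|n1 [|s [|r [|]]]]]; try discriminate Hl.
    + exists 0, (5 * s), 0, (s * (rho + 1)), n1, n0; split.
      * apply (vf_eq_on_trans _ _ _ _ HQ); intros t x u _; simpl; repeat split; field.
      * apply (case_solution_classifying (Power rho)); [apply HI|].
        simpl; repeat split; field.
    + exists 0, 0, (5 * s), s, n1, n0; split.
      * apply (vf_eq_on_trans _ _ _ _ HQ); intros t x u _; simpl; repeat split; field.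
      * apply (case_solution_classifying Expon); [apply HI|].
        simpl; repeat split; field.
    + exists s, 0, s, (s * nu), n1, n0; split.
      * apply (vf_eq_on_trans _ _ _ _ HQ); intros t x u _; simpl; repeat split; field.
      * apply (case_solution_classifying (Arctan nu)); [apply HI|].
        simpl; repeat split; field.
    + exists 0, (5 * r), s, r, n1, n0; split.
      * apply (vf_eq_on_trans _ _ _ _ HQ); intros t x u _; simpl; repeat split; field.
      * apply (case_solution_classifying Constant); [apply HI|].
        simpl; repeat split; field.
Qed.

Lemma case_extends cs I X U : is_open_interval X -> is_open_interval U ->
  case_param cs -> case_interval cs I ->
  extends_kernel X U (Eqn I (case_beta cs)).
Proof.
  intros HX HU Hp HI H.
  destruct (open_interval_two_points I (proj1 HI)) as (t & _ & Ht & _).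
  destruct (open_interval_two_points X HX) as (x & _ & Hx & _).
  destruct (open_interval_two_points U HU) as (u & _ & Hu & _).
  (* The first field beyond the kernel basis is selected: its [tau] is nonzero on the interval,
     whereas kernel fields have [tau = 0]. *)
  set (l := match cs with Constant => [0; 0; 1; 0] | _ => [0; 0; 1] end).
  assert (HA : A_max X U (Eqn I (case_beta cs)) (lincomb l (case_basis cs))).
  { apply A_max_case; trivial; exists l; split; [destruct cs; reflexivity|].
    intros s y v _; auto. }
  apply H, A_ker_iff in HA; destruct HA as (n1 & n0 & HA).
  destruct (HA t x u) as (H0 & _ & _); [repeat split; assumption|].
  pose proof (proj2 HI t Ht) as Hd; destruct cs; simpl in H0, Hd; nra.
Qed.

(** If all symmetries had [tau = 0], the condition would read [kappa beta = 0]; then [k = 0], and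
    only kernel fields would remain. *)
Lemma extension_classifying E X U : is_open_interval X -> is_open_interval U ->
  in_class E -> extends_kernel X U E ->
  exists a b c kappa : R, (a <> 0 \/ b <> 0 \/ c <> 0) /\
    classifying (dom E) (beta E) a b c kappa.
Proof.
  intros HX HU HE Hext; apply NNPP; intros Hno; apply Hext; intros Q; split.
  2: apply A_ker_subset_A_max; assumption.
  destruct HE as (HI & Hs & Hn) eqn:HE'; clear HE'; destruct E as (I, b0).
  intros HQ; apply A_max_iff in HQ; trivial.
  2: intros t Ht; apply (in_class_derivable _ t HE Ht).
  destruct HQ as (a & b & c & k & n1 & n0 & HQ & HC).
  destruct (Req_dec a 0) as [->|]; [|exfalso; apply Hno; exists a, b, c; eauto].
  destruct (Req_dec b 0) as [->|]; [|exfalso; apply Hno; exists 0, b, c; eauto].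
  destruct (Req_dec c 0) as [->|]; [|exfalso; apply Hno; exists 0, 0, c; eauto].
  destruct (open_interval_two_points I HI) as (t & _ & Ht & _).
  pose proof (HC t Ht) as H0; pose proof (Hn t Ht) as Hnz; simpl in H0, Hnz.
  assert (Hk : k * b0 t = 0) by lra.
  apply Rmult_integral in Hk; destruct Hk as [->|]; [|contradiction].
  apply A_ker_iff; exists n1, n0; exact HQ.
Qed.

(** * Equivalence *)

Definition moebius (A B C D t : R) : R := (A * t + B) / (C * t + D).

(* The coefficients [e0, e1] of a transformation only affect the [x] and [u]
   components, which range over the whole plane in [graph]. *)
Definition moebius_maps (A B C D e : R) (E E' : equation) : Prop :=
  A * D - B * C <> 0 /\ e <> 0 /\
  (forall t, dom E t -> C * t + D <> 0) /\
  (forall t', dom E' t' <-> exists t, dom E t /\ t' = moebius A B C D t) /\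
  (forall t, dom E t -> beta E' (moebius A B C D t)
     = e ^ 5 / (C * t + D) ^ 3 * (beta E t / (A * D - B * C))).

Lemma equivalent_iff E E' :
  equivalent E E' <-> exists A B C D e, moebius_maps A B C D e E E'.
Proof.
  split.
  - intros ([A B C D c0 c1 e] & (Hdet & He) & Hcd & Hmap); simpl in *.
    unfold g_det in Hdet; simpl in Hdet.
    assert (Hin : forall t, dom E t -> graph E' (moebius A B C D t)
      (x_new (Transf A B C D c0 c1 e) t 0) (u_new (Transf A B C D c0 c1 e) t 0 0)
      (beta_new (Transf A B C D c0 c1 e) t (beta E t))).
    { intros t Ht; apply Hmap; exists t, 0, 0, (beta E t); repeat split; trivial. }
    exists A, B, C, D, e; repeat split; trivial.
    + intros Ht'; destruct (proj1 (Hmap t' 0 0 (beta E' t')) (conj Ht' eq_refl))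
        as (t & x & u & b & (Ht & _) & -> & _); exists t; auto.
    + intros (t & Ht & ->); apply (Hin t Ht).
    + intros t Ht; symmetry; apply (Hin t Ht).
  - intros (A & B & C & D & e & Hdet & He & Hcd & Hdom & Hb).
    exists (Transf A B C D 0 0 e); repeat split; trivial.
    + intros (Ht' & ->); destruct (proj1 (Hdom t') Ht') as (t & Ht & ->).
      specialize (Hcd t Ht).
      (* These solve [x_new] and [u_new] for the old [x] and [u] when [e0 = e1 = 0]. *)
      exists t, (x' * (C * t + D) / e),
        ((u' * (A * D - B * C) + C * (x' * (C * t + D))) / (e * (C * t + D))),
        (beta E t).
      unfold x_new, u_new, beta_new, g_det; simpl.
      split; [split; trivial|split; [reflexivity|repeat split]].
      * field; split; assumption.
      * field; repeat split; assumption.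
      * rewrite Hb by assumption; reflexivity.
    + destruct H as (t & x & u & b & (Ht & ->) & -> & -> & -> & ->).
      apply Hdom; exists t; auto.
    + destruct H as (t & x & u & b & (Ht & ->) & -> & -> & -> & ->).
      symmetry; apply Hb, Ht.
Qed.

Lemma equivalent_refl E : equivalent E E.
Proof.
  apply equivalent_iff; exists 1, 0, 0, 1, 1.
  assert (Hid : forall t, moebius 1 0 0 1 t = t) by (intros; unfold moebius; field).
  repeat split; try lra; try (intros; lra).
  - intros Ht; exists t'; rewrite Hid; auto.
  - intros (t & Ht & ->); rewrite Hid; exact Ht.
  - intros t Ht; rewrite Hid; field; lra.
Qed.

(* The new coefficients are those of the pull-back of the vector field
   [(a s^2 + b s + c) d/ds] along the Moebius map. *)
Lemma classifying_pullback A B C D e E E' a b c kappa :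
  open (dom E) -> (forall t, dom E' t -> ex_derive (beta E') t) ->
  moebius_maps A B C D e E E' ->
  classifying (dom E') (beta E') a b c kappa ->
  classifying (dom E) (beta E)
    ((a * A ^ 2 + b * A * C + c * C ^ 2) / (A * D - B * C))
    ((2 * a * A * B + b * (A * D + B * C) + 2 * c * C * D) / (A * D - B * C))
    ((a * B ^ 2 + b * B * D + c * D ^ 2) / (A * D - B * C)) kappa.
Proof.
  intros Ho Hd (Hdet & He & Hcd & Hdom & Hb) HC t Ht.
  assert (Ht' : dom E' (moebius A B C D t)) by (apply Hdom; exists t; auto).
  pose proof (HC _ Ht') as H; pose proof (Hcd t Ht) as Hw.
  set (d := A * D - B * C) in *.
  assert (Heq : forall s, dom E s ->
    beta E s = beta E' (moebius A B C D s) * ((C * s + D) ^ 3 * (d / e ^ 5))).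
  { intros s Hs; rewrite Hb by assumption; field; repeat split; auto. }
  assert (Hder : Derive (beta E) t =
    d / (C * t + D) ^ 2 * Derive (beta E') (moebius A B C D t)
      * ((C * t + D) ^ 3 * (d / e ^ 5))
    + beta E' (moebius A B C D t) * (3 * C * (C * t + D) ^ 2 * (d / e ^ 5))).
  { apply is_derive_unique.
    apply (is_derive_ext_loc
      (fun s => beta E' (moebius A B C D s) * ((C * s + D) ^ 3 * (d / e ^ 5)))).
    - apply (filter_imp (dom E)); [intros s Hs; symmetry; auto | apply Ho, Ht].
    - apply (is_derive_mult (fun s => beta E' (moebius A B C D s))
               (fun s => (C * s + D) ^ 3 * (d / e ^ 5))).
      + apply (is_derive_comp (beta E') (moebius A B C D)).
        * apply Derive_correct, Hd, Ht'.
        * unfold moebius, d; auto_derive; [exact Hw | field; exact Hw].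
      + auto_derive; [trivial | field; exact He].
      + intros; apply Rmult_comm. }
  rewrite Hder, Heq by assumption.
  set (b0 := beta E' (moebius A B C D t)) in *.
  set (b1 := Derive (beta E') (moebius A B C D t)) in *.
  unfold moebius in H; apply Rminus_diag_uniq; apply Rminus_diag_eq in H.
  (* The defect of the condition is multiplied by the same factor that relates the two betas. *)
  transitivity ((C * t + D) ^ 3 * d / e ^ 5 *
    ((a * ((A * t + B) / (C * t + D)) ^ 2 + b * ((A * t + B) / (C * t + D)) + c) * b1
     - (3 / 2 * (2 * a * ((A * t + B) / (C * t + D)) + b) + kappa) * b0)).
  - unfold d in *; field; repeat split; auto.
  - rewrite H; ring.
Qed.

Lemma pullback_nonzero A B C D a b c : A * D - B * C <> 0 ->
  (a * A ^ 2 + b * A * C + c * C ^ 2) / (A * D - B * C) = 0 ->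
  (2 * a * A * B + b * (A * D + B * C) + 2 * c * C * D) / (A * D - B * C) = 0 ->
  (a * B ^ 2 + b * B * D + c * D ^ 2) / (A * D - B * C) = 0 ->
  a = 0 /\ b = 0 /\ c = 0.
Proof.
  intros Hd; set (d := A * D - B * C) in *.
  set (a' := _ / d); set (b' := (2 * a * A * B + _ + _) / d); set (c' := _ / d).
  intros Ha Hb Hc; repeat split.
  (* The three formulas are the pull-back along the inverse map, with matrix entries
     [D, - B, - C, A]. *)
  - transitivity ((a' * D ^ 2 - b' * C * D + c' * C ^ 2) / d);
      [unfold a', b', c', d in *; field; exact Hd | rewrite Ha, Hb, Hc; field; exact Hd].
  - transitivity ((- 2 * a' * B * D + b' * (A * D + B * C) - 2 * c' * A * C) / d);
      [unfold a', b', c', d in *; field; exact Hd | rewrite Ha, Hb, Hc; field; exact Hd].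
  - transitivity ((a' * B ^ 2 - b' * A * B + c' * A ^ 2) / d);
      [unfold a', b', c', d in *; field; exact Hd | rewrite Ha, Hb, Hc; field; exact Hd].
Qed.

(** Substitution multiplies the discriminant of a binary quadratic form by the squared determinant,
    which the division of all coefficients cancels. *)
Lemma pullback_discriminant A B C D a b c : A * D - B * C <> 0 ->
  ((2 * a * A * B + b * (A * D + B * C) + 2 * c * C * D) / (A * D - B * C)) ^ 2
  - 4 * ((a * A ^ 2 + b * A * C + c * C ^ 2) / (A * D - B * C))
      * ((a * B ^ 2 + b * B * D + c * D ^ 2) / (A * D - B * C))
  = b ^ 2 - 4 * a * c.
Proof. intros Hd; field; exact Hd. Qed.

Lemma equivalent_cases_solution cs cs' I I' a b c kappa :
  case_param cs -> case_interval cs I -> case_interval cs' I' ->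
  equivalent (Eqn I (case_beta cs)) (Eqn I' (case_beta cs')) ->
  case_solution cs' a b c kappa -> (a <> 0 \/ b <> 0 \/ c <> 0) ->
  exists a' b' c', case_solution cs a' b' c' kappa /\
    (a' <> 0 \/ b' <> 0 \/ c' <> 0) /\
    b' ^ 2 - 4 * a' * c' = b ^ 2 - 4 * a * c.
Proof.
  intros Hp HI HI' Heq Hs Hnz; apply equivalent_iff in Heq.
  destruct Heq as (A & B & C & D & e & Hm).
  pose proof (proj1 Hm) as Hd.
  do 3 eexists; split; [|split; [|apply (pullback_discriminant A B C D), Hd]].
  - apply (classifying_case_solution cs I); trivial.
    apply (classifying_pullback A B C D e
             (Eqn I (case_beta cs)) (Eqn I' (case_beta cs')) a b c kappa
             (open_interval_open I (proj1 HI))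
             (fun t Ht => case_beta_derivable cs' t (proj2 HI' t Ht)) Hm).
    apply case_solution_classifying; [apply HI' | exact Hs].
  - apply NNPP; intros H.
    destruct (pullback_nonzero A B C D a b c Hd) as (? & ? & ?); try tauto;
      apply NNPP; tauto.
Qed.

(** One nonzero solution of [cs'] is pulled back and must solve the condition of [cs]. Its
    discriminant is positive, zero or negative for powers, exponential and arctangent. The constant
    admits a positive and a zero one; there [kappa] decides, as [b = 1] or [b = -1] would force
    [rho] to be 0 or 3. The sign left open by the discriminant would replace [rho] by [3 - rho] or
    [nu] by [- nu], which the normalizations allow only at a fixed point. *)
Lemma equivalent_cases_eq cs cs' I I' : case_param cs -> case_param cs' ->
  case_interval cs I -> case_interval cs' I' ->
  equivalent (Eqn I (case_beta cs)) (Eqn I' (case_beta cs')) -> cs = cs'.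
Proof.
  intros Hp Hp' HI HI' Heq.
  pose proof (fun a b c k => equivalent_cases_solution cs cs' I I' a b c k Hp HI HI' Heq)
    as H; clear Heq HI HI'.
  destruct cs' as [rho'| |nu'|].
  - destruct (H 0 1 0 (rho' - 3 / 2)) as (a & b & c & Hs & Hnz & Hdisc);
      [simpl; lra | lra |].
    destruct cs as [rho| |nu|]; simpl in *.
    + destruct Hs as (-> & -> & Hs).
      assert (Hb : (b - 1) * (b + 1) = 0) by lra.
      apply Rmult_integral in Hb; destruct Hb as [Hb|Hb].
      * assert (b = 1) as -> by lra; f_equal; lra.
      * assert (b = -1) as -> by lra; f_equal; lra.
    + exfalso; destruct Hs as (-> & -> & _); lra.
    + exfalso; destruct Hs as (-> & -> & _); nra.
    + exfalso; destruct Hs as (-> & Hs).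
      assert (Hb : (b - 1) * (b + 1) = 0) by lra.
      apply Rmult_integral in Hb; lra.
  - destruct (H 0 0 1 1) as (a & b & c & Hs & Hnz & Hdisc); [simpl; lra | lra |].
    destruct cs as [rho| |nu|]; simpl in *; trivial; exfalso.
    + destruct Hs as (-> & -> & Hs); assert (b * b = 0) by lra; nra.
    + destruct Hs as (-> & -> & Hs); nra.
    + destruct Hs as (-> & Hs); assert (b * b = 0) by lra; nra.
  - destruct (H 1 0 1 (5 * nu')) as (a & b & c & Hs & Hnz & Hdisc);
      [simpl; lra | lra |].
    destruct cs as [rho| |nu|]; simpl in *.
    + exfalso; destruct Hs as (-> & -> & _); nra.
    + exfalso; destruct Hs as (-> & -> & _); lra.
    + destruct Hs as (-> & -> & Hs).
      assert (Hc : (c - 1) * (c + 1) = 0) by lra.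
      apply Rmult_integral in Hc; destruct Hc as [Hc|Hc].
      * assert (c = 1) as -> by lra; f_equal; lra.
      * assert (c = -1) as -> by lra; f_equal; lra.
    + exfalso; destruct Hs as (-> & _); nra.
  - destruct (H 0 0 1 0) as (a & b & c & Hs & Hnz & Hdisc); [simpl; lra | lra |].
    destruct cs as [rho| |nu|]; simpl in *; trivial; exfalso.
    + destruct Hs as (-> & -> & Hs); nra.
    + destruct Hs as (-> & -> & Hs); lra.
    + destruct Hs as (-> & -> & Hs); nra.
Qed.

(** * Moebius images of intervals *)

Lemma affine_same_sign I p q s t : is_open_interval I ->
  (forall r, I r -> p * r + q <> 0) -> I s -> I t ->
  0 < (p * s + q) * (p * t + q).
Proof.
  intros HI H Hs Ht; pose proof (H s Hs) as Hps; pose proof (H t Ht) as Hpt.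
  destruct (Rlt_or_le 0 ((p * s + q) * (p * t + q))) as [|Hle]; [assumption|].
  exfalso.
  destruct (Req_dec p 0) as [->|Hp]; [nra|].
  apply (H (- q / p)); [|field; exact Hp].
  (* Opposite signs would place the root [- q / p] between [s] and [t], hence in the interval. *)
  assert (Hr : (s - - q / p) * (t - - q / p) <= 0).
  { replace ((s - - q / p) * (t - - q / p))
      with ((p * s + q) * (p * t + q) * / p ^ 2) by (field; exact Hp).
    pose proof (Rinv_0_lt_compat (p ^ 2) ltac:(nra)); nra. }
  destruct (Rle_dec s t).
  - apply (open_interval_convex I s t); trivial; nra.
  - apply (open_interval_convex I t s); trivial; nra.
Qed.

(** Convexity without extremal points can be checked on a Moebius image without computing its
    endpoints, which may be infinite. *)
Lemma convex_open_interval (J : R -> Prop) : (exists t, J t) ->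
  (forall t, J t -> exists s r, J s /\ J r /\ s < t < r) ->
  (forall s t r, J s -> J t -> s <= r <= t -> J r) -> is_open_interval J.
Proof.
  intros (t0 & H0) Hopen Hconv.
  destruct (Glb_Rbar_correct J) as (Glo & Ghi).
  destruct (Lub_Rbar_correct J) as (Llo & Lhi).
  assert (Hin : forall t, J t -> Rbar_lt (Glb_Rbar J) t /\ Rbar_lt t (Lub_Rbar J)).
  { intros t Ht; destruct (Hopen t Ht) as (s & r & Hs & Hr & Hlt); split.
    - apply (Rbar_le_lt_trans _ s); [apply Glo, Hs | apply Hlt].
    - apply (Rbar_lt_le_trans _ r); [apply Hlt | apply Llo, Hr]. }
  exists (Glb_Rbar J), (Lub_Rbar J); split.
  - apply (Rbar_lt_trans _ t0); apply Hin, H0.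
  - intros t; split; [apply Hin|]; intros (Hlo & Hhi).
    assert (Hs : exists s, J s /\ s <= t).
    { apply NNPP; intros Hno; apply (Rbar_lt_not_le _ _ Hlo), Ghi.
      intros s Hs; simpl; apply Rnot_lt_le; intros Hlt; apply Hno.
      exists s; split; [exact Hs | lra]. }
    assert (Hr : exists r, J r /\ t <= r).
    { apply NNPP; intros Hno; apply (Rbar_lt_not_le _ _ Hhi), Lhi.
      intros s Hs'; simpl; apply Rnot_lt_le; intros Hlt; apply Hno.
      exists s; split; [exact Hs' | lra]. }
    destruct Hs as (s & Hs & ?), Hr as (r & Hr & ?).
    apply (Hconv s r); auto.
Qed.

Lemma moebius_image_interval I A B C D : is_open_interval I ->
  A * D - B * C <> 0 -> (forall t, I t -> C * t + D <> 0) ->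
  is_open_interval (fun s => exists t, I t /\ s = moebius A B C D t).
Proof.
  intros HI Hd Hw.
  (* By [affine_same_sign] the product of denominators is positive, so this difference formula makes
     the map strictly monotone on the interval. *)
  assert (Hsub : forall s t, I s -> I t ->
    moebius A B C D t - moebius A B C D s
    = (A * D - B * C) * (t - s) * / ((C * s + D) * (C * t + D))).
  { intros s t Hs Ht; unfold moebius; field; auto. }
  apply convex_open_interval.
  - destruct (open_interval_two_points I HI) as (t & _ & Ht & _).
    exists (moebius A B C D t), t; auto.
  - intros ? (t & Ht & ->).
    destruct (open_interval_open I HI t Ht) as (eps & Heps).
    pose proof (cond_pos eps) as Hpos.
    assert (H1 : I (t - eps / 2)).
    { apply Heps; unfold ball; simpl; unfold AbsRing_ball, abs, minus, plus, opp; simpl.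
      rewrite Rabs_left; lra. }
    assert (H2 : I (t + eps / 2)).
    { apply Heps; unfold ball; simpl; unfold AbsRing_ball, abs, minus, plus, opp; simpl.
      rewrite Rabs_right; lra. }
    pose proof (affine_same_sign I C D _ _ HI Hw H1 Ht) as P1.
    pose proof (affine_same_sign I C D _ _ HI Hw Ht H2) as P2.
    pose proof (Hsub _ _ H1 Ht) as D1; pose proof (Hsub _ _ Ht H2) as D2.
    apply Rinv_0_lt_compat in P1; apply Rinv_0_lt_compat in P2.
    set (v1 := / ((C * (t - eps / 2) + D) * _)) in *.
    set (v2 := / ((C * t + D) * (C * (t + eps / 2) + D))) in *.
    assert (Hv1 : 0 < eps / 2 * v1) by (apply Rmult_lt_0_compat; lra).
    assert (Hv2 : 0 < eps / 2 * v2) by (apply Rmult_lt_0_compat; lra).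
    replace ((A * D - B * C) * (t - (t - eps / 2)) * v1)
      with ((A * D - B * C) * (eps / 2 * v1)) in D1 by field.
    replace ((A * D - B * C) * (t + eps / 2 - t) * v2)
      with ((A * D - B * C) * (eps / 2 * v2)) in D2 by field.
    destruct (Rlt_or_le 0 (A * D - B * C)) as [Hs|Hs].
    + pose proof (Rmult_lt_0_compat _ _ Hs Hv1).
      pose proof (Rmult_lt_0_compat _ _ Hs Hv2).
      exists (moebius A B C D (t - eps / 2)), (moebius A B C D (t + eps / 2)).
      split; [eauto|split; [eauto|lra]].
    + assert (Hs' : 0 < - (A * D - B * C)) by lra.
      pose proof (Rmult_lt_0_compat _ _ Hs' Hv1).
      pose proof (Rmult_lt_0_compat _ _ Hs' Hv2).
      exists (moebius A B C D (t + eps / 2)), (moebius A B C D (t - eps / 2)).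
      split; [eauto|split; [eauto|lra]].
  - intros ? ? r (s & Hs & ->) (t & Ht & ->) Hr.
    destruct (Req_dec (moebius A B C D s) (moebius A B C D t)) as [He|He].
    { exists s; split; [exact Hs | lra]. }
    pose proof (affine_same_sign I C D _ _ HI Hw Hs Ht) as Hp.
    pose proof (Hw s Hs) as Hws; pose proof (Hw t Ht) as Hwt.
    set (l := (r - moebius A B C D s) / (moebius A B C D t - moebius A B C D s)).
    assert (Hl : 0 <= l <= 1).
    { unfold l; split.
      - apply Rdiv_le_0_compat; lra.
      - apply Rle_div_l; lra. }
    assert (Hrl : r = moebius A B C D s
                      + l * (moebius A B C D t - moebius A B C D s)).
    { unfold l; field; lra. }
    (* A convex combination of images is the image of the convex combination
       with weights rescaled by the denominators. *)
    set (w := (1 - l) * (C * t + D) + l * (C * s + D)).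
    assert (Hw0 : w * (C * s + D) > 0).
    { assert (Hq : 0 < (C * s + D) ^ 2) by (apply pow2_gt_0, Hws).
      replace (w * (C * s + D)) with
        ((1 - l) * ((C * s + D) * (C * t + D)) + l * (C * s + D) ^ 2)
        by (unfold w; ring).
      destruct (Req_dec l 1) as [->|Hl1]; [lra|].
      assert (0 < (1 - l) * ((C * s + D) * (C * t + D)))
        by (apply Rmult_lt_0_compat; lra).
      assert (0 <= l * (C * s + D) ^ 2) by (apply Rmult_le_pos; lra).
      lra. }
    assert (Hwn : w <> 0) by (intros E0; rewrite E0 in Hw0; lra).
    set (m := l * (C * s + D) / w).
    assert (Hm : 0 <= m <= 1).
    { assert (Hq : 0 < / (w * (C * s + D))) by (apply Rinv_0_lt_compat; lra).
      unfold m; replace (l * (C * s + D) / w)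
        with (l * (C * s + D) ^ 2 * / (w * (C * s + D))) by (field; auto).
      split.
      - apply Rmult_le_pos; [apply Rmult_le_pos; [lra | apply pow2_ge_0] | lra].
      - replace 1 with (w * (C * s + D) * / (w * (C * s + D))) by (field; auto).
        apply Rmult_le_compat_r; [lra|].
        assert (0 <= (1 - l) * ((C * s + D) * (C * t + D)))
          by (apply Rmult_le_pos; lra).
        unfold w; lra. }
    assert (Hi : I (s + m * (t - s))).
    { destruct (Rle_dec s t).
      - apply (open_interval_convex I s t); trivial; nra.
      - apply (open_interval_convex I t s); trivial; nra. }
    exists (s + m * (t - s)); split; [exact Hi|].
    specialize (Hw _ Hi); rewrite Hrl.
    assert (Hden : (C * (s + m * (t - s)) + D) = (C * s + D) * (C * t + D) / w).
    { unfold m; unfold w in *; field; exact Hwn. }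
    unfold moebius; rewrite Hden; unfold m, w in *; field; repeat split; auto.
Qed.

Lemma proportional_of_same_ode I (f g : R -> R) : is_open_interval I ->
  (forall t, I t -> ex_derive f t) -> (forall t, I t -> ex_derive g t) ->
  (forall t, I t -> g t <> 0) ->
  (forall t, I t -> Derive f t * g t = f t * Derive g t) ->
  exists K, forall t, I t -> f t = K * g t.
Proof.
  intros HI Hf Hg Hn H.
  destruct (open_interval_two_points I HI) as (t0 & _ & Ht0 & _).
  exists (f t0 / g t0); intros t Ht.
  rewrite <- (is_derive_zero_const I (fun s => f s / g s) HI) with (s := t) (t := t0);
    trivial; [field; auto|].
  intros s Hs.
  replace 0 with ((Derive f s * g s - f s * Derive g s) / g s ^ 2)
    by (rewrite H by exact Hs; field; auto).
  apply is_derive_div; [apply Derive_correct|apply Derive_correct|]; auto.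
Qed.

(** The exponent of [e2] is odd, so constants of either sign are absorbed, in particular those of a
    negative beta. *)
Lemma fifth_root y : y <> 0 -> exists z, z <> 0 /\ z ^ 5 = y.
Proof.
  assert (Hpos : forall y, 0 < y -> exists z, 0 < z /\ z ^ 5 = y).
  { intros r Hr; exists (exp (ln r / 5)); split; [apply exp_pos|].
    simpl; rewrite Rmult_1_r, <- !exp_plus.
    replace (_ + _) with (ln r) by field; apply exp_ln, Hr. }
  intros Hy; destruct (Rlt_or_le 0 y) as [H|H].
  - destruct (Hpos y H) as (z & Hz & <-); exists z; split; [lra | reflexivity].
  - destruct (Hpos (- y)) as (z & Hz & Hzy); [lra|].
    exists (- z); split; [lra|]; replace ((- z) ^ 5) with (- z ^ 5) by ring; lra.
Qed.

(** * Reduction to the listed cases *)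

Section Equivalence.
Variable E : equation.
Hypothesis HI : is_open_interval (dom E).
Hypothesis beta_derivable : forall t, dom E t -> ex_derive (beta E) t.
Hypothesis beta_nonzero : forall t, dom E t -> beta E t <> 0.

(* Both [beta E] and the pull-back of the case function solve the same linear
   first-order equation, so they agree up to a constant, which [e2] absorbs. *)
Lemma equivalent_of_solution cs A B C D a b c a' b' c' kappa :
  A * D - B * C <> 0 ->
  (forall t, dom E t -> C * t + D <> 0) ->
  (forall t, dom E t -> case_dom cs (moebius A B C D t)) ->
  case_solution cs a b c kappa ->
  a' * (A * D - B * C) = a * A ^ 2 + b * A * C + c * C ^ 2 ->
  b' * (A * D - B * C) = 2 * a * A * B + b * (A * D + B * C) + 2 * c * C * D ->
  c' * (A * D - B * C) = a * B ^ 2 + b * B * D + c * D ^ 2 ->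
  (forall t, dom E t -> a' * t ^ 2 + b' * t + c' <> 0) ->
  classifying (dom E) (beta E) a' b' c' kappa ->
  exists I', case_interval cs I' /\ equivalent E (Eqn I' (case_beta cs)).
Proof.
  intros Hd Hw Hdom Hs Ha Hb Hc Hq HC.
  set (I' := fun s => exists t, dom E t /\ s = moebius A B C D t).
  assert (HI' : case_interval cs I').
  { split; [apply moebius_image_interval; assumption|].
    intros ? (t & Ht & ->); auto. }
  set (g := fun t => case_beta cs (moebius A B C D t)
                     * ((C * t + D) ^ 3 * (A * D - B * C))).
  assert (Hg0 : forall t, dom E t -> g t <> 0).
  { intros t Ht; pose proof (case_beta_pos cs (moebius A B C D t)).
    unfold g; repeat apply Rmult_integral_contrapositive_currified; auto; lra. }
  assert (Hmg : moebius_maps A B C D 1 (Eqn (dom E) g) (Eqn I' (case_beta cs))).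
  { repeat split; simpl; trivial; try lra.
    intros t Ht; unfold g; field; auto. }
  assert (Hgd : forall t, dom E t -> ex_derive g t).
  { intros t Ht; unfold g; apply ex_derive_mult.
    - apply ex_derive_comp; [apply case_beta_derivable; auto|].
      unfold moebius; auto_derive; auto.
    - auto_derive; trivial. }
  pose proof (classifying_pullback A B C D 1 (Eqn (dom E) g) (Eqn I' (case_beta cs))
    a b c kappa (open_interval_open _ HI)
    (fun t Ht => case_beta_derivable cs t (proj2 HI' t Ht)) Hmg
    (case_solution_classifying cs I' a b c kappa (proj2 HI') Hs)) as HCg.
  cbn [dom beta] in HCg; rewrite <- Ha, <- Hb, <- Hc in HCg.
  unfold Rdiv in HCg; rewrite !Rinv_r_simpl_l in HCg by exact Hd.
  destruct (proportional_of_same_ode (dom E) (beta E) g) as (K & HK); trivial.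
  (* Both functions satisfy the condition with the same quadratic; dividing by it is possible
     because its roots lie outside the interval. *)
  { intros t Ht; pose proof (HC t Ht) as H1; pose proof (HCg t Ht) as H2.
    pose proof (Hq t Ht) as H0; apply (Rmult_eq_reg_l _ _ _) with (2 := H0).
    match goal with |- ?q * (?db * ?v) = ?q * (?w * ?dg) =>
      transitivity (q * db * v); [ring|]; transitivity (q * dg * w); [|ring]
    end.
    rewrite H1, H2; ring. }
  exists I'; split; [exact HI'|]; apply equivalent_iff.
  assert (HK0 : K <> 0).
  { destruct (open_interval_two_points _ HI) as (t & _ & Ht & _).
    intros ->; apply (beta_nonzero t Ht); rewrite HK by exact Ht; ring. }
  destruct (fifth_root (/ K)) as (e & He & He5); [apply Rinv_neq_0_compat, HK0|].
  exists A, B, C, D, e; repeat split; trivial; cbn [dom beta].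
  intros t Ht; rewrite HK, He5 by exact Ht; unfold g; field; repeat split; auto.
Qed.

Definition listed : Prop := exists cs I', case_param cs /\ case_interval cs I' /\
  equivalent E (Eqn I' (case_beta cs)).

Lemma listed_of_solution cs A B C D a b c a' b' c' kappa : case_param cs ->
  A * D - B * C <> 0 ->
  (forall t, dom E t -> C * t + D <> 0) ->
  (forall t, dom E t -> case_dom cs (moebius A B C D t)) ->
  case_solution cs a b c kappa ->
  a' * (A * D - B * C) = a * A ^ 2 + b * A * C + c * C ^ 2 ->
  b' * (A * D - B * C) = 2 * a * A * B + b * (A * D + B * C) + 2 * c * C * D ->
  c' * (A * D - B * C) = a * B ^ 2 + b * B * D + c * D ^ 2 ->
  (forall t, dom E t -> a' * t ^ 2 + b' * t + c' <> 0) ->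
  classifying (dom E) (beta E) a' b' c' kappa -> listed.
Proof.
  intros Hp Hd Hw Hdom Hs Ha Hb Hc Hq HC.
  destruct (equivalent_of_solution cs A B C D a b c a' b' c' kappa) as (I' & ? & ?);
    trivial; exists cs, I'; auto.
Qed.

Lemma listed_of_constant_tau c kappa : c <> 0 ->
  classifying (dom E) (beta E) 0 0 c kappa -> listed.
Proof.
  intros Hc HC; destruct (Req_dec kappa 0) as [->|Hk].
  - apply (listed_of_solution Constant 1 0 0 1 0 0 c 0 0 c 0); simpl; trivial;
      try (intros; lra).
  - assert (Hkc : kappa / c <> 0).
    { apply Rmult_integral_contrapositive_currified; [|apply Rinv_neq_0_compat];
        assumption. }
    (* Rescaling [t] by [kappa / c] turns [tau = c] into [tau = kappa], as the exponential
       requires. *)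
    apply (listed_of_solution Expon (kappa / c) 0 0 1 0 0 kappa 0 0 c kappa);
      simpl; trivial; try (intros; lra).
    field; assumption.
Qed.

(** A multiple of [1 / (t - r)] as new variable sends the root to infinity and makes [tau] constant;
    the multiple [- kappa / a] makes that constant equal to [kappa]. *)
Lemma listed_of_double_root r a kappa : a <> 0 ->
  (forall t, dom E t -> t - r <> 0) ->
  classifying (dom E) (beta E) a (- 2 * a * r) (a * r ^ 2) kappa -> listed.
Proof.
  intros Ha Hr HC.
  assert (Hq : forall t, dom E t -> a * t ^ 2 + - 2 * a * r * t + a * r ^ 2 <> 0).
  { intros t Ht; replace (_ + _) with (a * (t - r) ^ 2) by ring.
    apply Rmult_integral_contrapositive_currified, pow_nonzero; auto. }
  destruct (Req_dec kappa 0) as [->|Hk].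
  - apply (listed_of_solution Constant 0 1 1 (- r) 0 0 (- a)
             a (- 2 * a * r) (a * r ^ 2) 0); simpl; trivial; try lra.
    intros t Ht; pose proof (Hr t Ht); lra.
  - assert (Hka : kappa / a <> 0).
    { apply Rmult_integral_contrapositive_currified; [|apply Rinv_neq_0_compat];
        assumption. }
    apply (listed_of_solution Expon 0 (- (kappa / a)) 1 (- r) 0 0 kappa
             a (- 2 * a * r) (a * r ^ 2) kappa); simpl; trivial; try lra.
    + intros t Ht; pose proof (Hr t Ht); lra.
    + field; exact Ha.
    + field; exact Ha.
    + field; exact Ha.
Qed.

(* [tau] has the two roots sent to [0] and [infinity]. The exponent [rho] is
   replaced by [3 - rho] by exchanging the roots. *)
Lemma listed_of_two_roots A B C D b a' b' c' kappa : b <> 0 ->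
  A * D - B * C <> 0 ->
  (forall t, dom E t -> C * t + D <> 0) ->
  (forall t, dom E t -> 0 < moebius A B C D t) ->
  a' * (A * D - B * C) = b * A * C ->
  b' * (A * D - B * C) = b * (A * D + B * C) ->
  c' * (A * D - B * C) = b * B * D ->
  classifying (dom E) (beta E) a' b' c' kappa -> listed.
Proof.
  intros Hb Hd Hw Hpos Ea Eb Ec HC.
  assert (Hd' : C * B - D * A <> 0) by lra.
  assert (Hw' : forall t, dom E t -> A * t + B <> 0).
  { intros t Ht H; specialize (Hpos t Ht); unfold moebius in Hpos.
    rewrite H in Hpos; unfold Rdiv in Hpos; lra. }
  assert (Hpos' : forall t, dom E t -> 0 < moebius C D A B t).
  { intros t Ht; replace (moebius C D A B t) with (/ moebius A B C D t)
      by (unfold moebius; field; split; [apply Hw' | apply Hw]; exact Ht).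
    apply Rinv_0_lt_compat, Hpos, Ht. }
  assert (Hq : forall t, dom E t -> a' * t ^ 2 + b' * t + c' <> 0).
  { intros t Ht H.
    assert (H0 : b * (A * t + B) * (C * t + D) = 0).
    { transitivity (a' * (A * D - B * C) * t ^ 2 + b' * (A * D - B * C) * t
                    + c' * (A * D - B * C)); [rewrite Ea, Eb, Ec; ring|].
      transitivity ((a' * t ^ 2 + b' * t + c') * (A * D - B * C));
        [ring | rewrite H; ring]. }
    pose proof (Hw t Ht); pose proof (Hw' t Ht).
    repeat (apply Rmult_integral in H0; destruct H0 as [H0|H0]); contradiction. }
  set (rho := kappa / b + 3 / 2).
  assert (Hk : kappa = b * (rho - 3 / 2)) by (unfold rho; field; exact Hb).
  destruct (Req_dec rho 0) as [H0|H0].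
  { apply (listed_of_solution Constant A B C D 0 b 0 a' b' c' kappa); simpl;
      trivial; try lra; rewrite Hk, H0; lra. }
  (* Exchanging the roots turns the exponent 3 into 0, so this is again the constant case. *)
  destruct (Req_dec rho 3) as [H3|H3].
  { apply (listed_of_solution Constant C D A B 0 (- b) 0 a' b' c' kappa); simpl;
      trivial; try lra; rewrite Hk, H3; lra. }
  destruct (Rle_dec rho (3 / 2)) as [Hle|Hgt].
  - apply (listed_of_solution (Power rho) A B C D 0 b 0 a' b' c' kappa); simpl;
      trivial; lra.
  - apply (listed_of_solution (Power (3 - rho)) C D A B 0 (- b) 0 a' b' c' kappa);
      simpl; trivial; try lra.
Qed.

(** The variable [(t - p) / q] moves the complex roots [p + i q] and [p - i q] to [i] and [- i]. The
    sign of [q] is free and is chosen to make [nu] nonnegative. *)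
Lemma listed_of_no_root a b c kappa : a <> 0 -> b ^ 2 - 4 * a * c < 0 ->
  classifying (dom E) (beta E) a b c kappa -> listed.
Proof.
  intros Ha Hdisc HC.
  set (p := - b / (2 * a)).
  assert (Hq2 : 0 < c / a - p ^ 2).
  { replace (c / a - p ^ 2) with (- (b ^ 2 - 4 * a * c) * / (4 * a ^ 2))
      by (unfold p; field; exact Ha).
    apply Rmult_lt_0_compat; [lra|]; apply Rinv_0_lt_compat.
    pose proof (pow2_gt_0 a Ha); lra. }
  assert (Hq : exists q, q <> 0 /\ q ^ 2 = c / a - p ^ 2 /\ 0 <= kappa / (5 * a * q)).
  { pose proof (sqrt_lt_R0 _ Hq2) as Hs.
    assert (Hs2 : sqrt (c / a - p ^ 2) ^ 2 = c / a - p ^ 2) by (apply pow2_sqrt; lra).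
    set (q := sqrt (c / a - p ^ 2)) in *.
    destruct (Rle_dec 0 (kappa / (5 * a * q))).
    - exists q; repeat split; trivial; lra.
    - exists (- q); repeat split; [lra | rewrite <- Hs2; ring|].
      replace (kappa / (5 * a * - q)) with (- (kappa / (5 * a * q)))
        by (field; split; lra).
      lra. }
  destruct Hq as (q & Hq0 & Hqq & Hnu).
  apply (listed_of_solution (Arctan (kappa / (5 * a * q))) 1 (- p) 0 q
           (a * q) 0 (a * q) a b c kappa); simpl; trivial; try lra.
  - intros; lra.
  - repeat split; field; auto.
  - unfold p; field; exact Ha.
  - transitivity (a * (q ^ 2 + p ^ 2) * q); [|ring].
    rewrite Hqq; field; exact Ha.
  - intros t _ H.
    assert (H' : (2 * a * t + b) ^ 2 = b ^ 2 - 4 * a * c).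
    { transitivity (4 * a * (a * (t * (t * 1)) + b * t + c) + (b ^ 2 - 4 * a * c));
        [ring | rewrite H; ring]. }
    pose proof (pow2_ge_0 (2 * a * t + b)); lra.
Qed.

(** At [r] itself, [F r] is the derivative of [(s - r) F s], which vanishes identically near [r]. *)
Lemma cancel_linear_factor (F : R -> R) r : dom E r -> ex_derive F r ->
  (forall t, dom E t -> (t - r) * F t = 0) -> forall t, dom E t -> F t = 0.
Proof.
  intros Hr HF H t Ht; destruct (Req_dec t r) as [->|Htr].
  2: { apply H, Rmult_integral in Ht; destruct Ht; lra. }
  assert (H0 : is_derive (fun s => (s - r) * F s) r (F r)).
  { replace (F r) with (1 * F r + (r - r) * Derive F r) by ring.
    apply (is_derive_mult (fun s => s - r) F).
    - auto_derive; [trivial | ring].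
    - apply Derive_correct, HF.
    - intros; apply Rmult_comm. }
  rewrite <- (is_derive_unique _ _ _ H0).
  rewrite (Derive_ext_loc _ (fun _ => 0)); [apply Derive_const|].
  apply (filter_imp (dom E)); [exact H | apply (open_interval_open _ HI), Hr].
Qed.

Hypothesis beta_derivable2 : forall t, dom E t -> ex_derive (Derive (beta E)) t.

Lemma root_side r : (forall t, dom E t -> t - r <> 0) ->
  exists s, (s = 1 \/ s = -1) /\ forall t, dom E t -> 0 < s * (t - r).
Proof.
  intros Hr; destruct (open_interval_two_points _ HI) as (t0 & _ & Ht0 & _).
  assert (H : forall t, dom E t -> 0 < (t0 - r) * (t - r)).
  { intros t Ht.
    pose proof (affine_same_sign (dom E) 1 (- r) t0 t HI) as H.
    replace ((t0 - r) * (t - r)) with ((1 * t0 + - r) * (1 * t + - r)) by ring.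
    apply H; trivial; intros s Hs E0; apply (Hr s Hs); lra. }
  destruct (Rlt_or_le 0 (t0 - r)) as [Hs|Hs].
  - exists 1; split; [auto|]; intros t Ht; specialize (H t Ht); nra.
  - exists (-1); split; [auto|]; intros t Ht; specialize (H t Ht); nra.
Qed.

(** If the root lies inside, the condition at [r] forces [kappa = - 3/2 b], because beta is nonzero
    there. What remains is [(t - r) beta' = 0], so beta is constant. *)
Lemma listed_of_linear_tau b r kappa : b <> 0 ->
  classifying (dom E) (beta E) 0 b (- b * r) kappa -> listed.
Proof.
  intros Hb HC; destruct (classic (dom E r)) as [Hr|Hr].
  - apply (listed_of_constant_tau 1 0); [lra|].
    assert (H0 : (3 / 2 * b + kappa) * beta E r = 0).
    { pose proof (HC r Hr); lra. }
    apply Rmult_integral in H0; destruct H0 as [H0|H0];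
      [|exfalso; exact (beta_nonzero r Hr H0)].
    assert (Hd : forall t, dom E t -> Derive (beta E) t = 0).
    { apply (cancel_linear_factor _ r); auto.
      intros t Ht; apply (Rmult_eq_reg_l b); [|exact Hb].
      pose proof (HC t Ht) as H.
      replace kappa with (- (3 / 2 * b)) in H by lra; lra. }
    intros t Ht; rewrite Hd by exact Ht; ring.
  - destruct (root_side r) as (s & Hs & Hsgn).
    { intros t Ht H; apply Hr; replace r with t by lra; exact Ht. }
    apply (listed_of_two_roots s (- s * r) 0 1 b 0 b (- b * r) kappa); trivial.
    + destruct Hs as [->| ->]; lra.
    + intros; lra.
    + intros t Ht; unfold moebius.
      replace (_ / _) with (s * (t - r)) by field; auto.
    + ring.
    + ring.
    + ring.
Qed.

(** Evaluation at an inner root fixes [kappa]. Two inner roots give opposite values, so they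
    coincide and [kappa = 0]; then [(t - r1) beta' = 3 beta] contradicts that beta is nonzero at
    [r1]. *)
Lemma listed_of_quadratic_tau a r1 r2 kappa : a <> 0 ->
  classifying (dom E) (beta E) a (- a * (r1 + r2)) (a * r1 * r2) kappa -> listed.
Proof.
  assert (Hout : forall r, ~ dom E r -> forall t, dom E t -> t - r <> 0).
  { intros r Hr t Ht H; apply Hr; replace r with t by lra; exact Ht. }
  assert (Hwlog : forall r1 r2, a <> 0 -> ~ dom E r1 ->
    classifying (dom E) (beta E) a (- a * (r1 + r2)) (a * r1 * r2) kappa -> listed).
  { clear r1 r2; intros r1 r2 Ha H1 HC.
    destruct (Req_dec r1 r2) as [<-|Hne].
    { apply (listed_of_double_root r1 a kappa Ha (Hout _ H1)).
      intros t Ht; pose proof (HC t Ht); lra. }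
    destruct (classic (dom E r2)) as [H2|H2].
    - (* [beta] is a multiple of [(t - r1)^3]. *)
      apply (listed_of_double_root r1 1 0); [lra | auto|].
      assert (H0 : (3 / 2 * (a * (r2 - r1)) + kappa) * beta E r2 = 0).
      { pose proof (HC r2 H2); lra. }
      apply Rmult_integral in H0; destruct H0 as [H0|H0];
        [|exfalso; exact (beta_nonzero r2 H2 H0)].
      assert (HF : forall t, dom E t ->
        (t - r1) * Derive (beta E) t - 3 * beta E t = 0).
      { apply (cancel_linear_factor _ r2 H2).
        - apply @ex_derive_minus; [|apply ex_derive_scal; auto].
          apply ex_derive_mult; [auto_derive; trivial | auto].
        - intros t Ht; apply (Rmult_eq_reg_l a); [|exact Ha].
          pose proof (HC t Ht) as H.
          replace kappa with (- (3 / 2 * (a * (r2 - r1)))) in H by lra; lra. }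
      intros t Ht; specialize (HF t Ht).
      transitivity ((t - r1) * ((t - r1) * Derive (beta E) t)); [ring|].
      replace ((t - r1) * Derive (beta E) t) with (3 * beta E t) by lra; field.
    - destruct (root_side r1 (Hout _ H1)) as (s1 & Hs1 & Hp1).
      destruct (root_side r2 (Hout _ H2)) as (s2 & Hs2 & Hp2).
      assert (Hs : s1 * s2 = 1 \/ s1 * s2 = -1).
      { destruct Hs1 as [->| ->], Hs2 as [->| ->]; lra. }
      (* The new variable [s1 s2 (t - r2) / (t - r1)] sends [r2] to 0 and [r1] to infinity; the
         signs make it positive on the interval. *)
      apply (listed_of_two_roots (s1 * s2) (- (s1 * s2) * r2) 1 (- r1) (a * (r2 - r1))
               a (- a * (r1 + r2)) (a * r1 * r2) kappa); trivial.
      + intros H; apply Rmult_integral in H; lra.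
      + destruct Hs as [->| ->]; lra.
      + intros t Ht; pose proof (Hout _ H1 t Ht); lra.
      + intros t Ht; unfold moebius.
        pose proof (Hout _ H1 t Ht); specialize (Hp1 t Ht); specialize (Hp2 t Ht).
        replace (_ / _) with ((s1 * (t - r1)) * (s2 * (t - r2)) * / (t - r1) ^ 2)
          by (field; lra).
        apply Rmult_lt_0_compat; [apply Rmult_lt_0_compat; assumption|].
        apply Rinv_0_lt_compat, pow2_gt_0; assumption.
      + ring.
      + ring.
      + ring. }
  intros Ha HC; destruct (classic (dom E r1)) as [H1|H1]; [|eauto].
  destruct (classic (dom E r2)) as [H2|H2].
  - exfalso.
    assert (Hk1 : (3 / 2 * (a * (r1 - r2)) + kappa) * beta E r1 = 0).
    { pose proof (HC r1 H1); lra. }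
    assert (Hk2 : (3 / 2 * (a * (r2 - r1)) + kappa) * beta E r2 = 0).
    { pose proof (HC r2 H2); lra. }
    apply Rmult_integral in Hk1; destruct Hk1 as [Hk1|Hk1];
      [|exact (beta_nonzero r1 H1 Hk1)].
    apply Rmult_integral in Hk2; destruct Hk2 as [Hk2|Hk2];
      [|exact (beta_nonzero r2 H2 Hk2)].
    assert (Hr : a * (r1 - r2) = 0) by lra.
    apply Rmult_integral in Hr; destruct Hr as [Hr|Hr]; [contradiction|].
    assert (r2 = r1) as -> by lra; assert (kappa = 0) as -> by lra.
    assert (HF : forall t, dom E t ->
      (t - r1) * Derive (beta E) t - 3 * beta E t = 0).
    { apply (cancel_linear_factor _ r1 H1).
      - apply @ex_derive_minus; [|apply ex_derive_scal; auto].
        apply ex_derive_mult; [auto_derive; trivial | auto].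
      - intros t Ht; apply (Rmult_eq_reg_l a); [|exact Ha].
        pose proof (HC t Ht) as H; lra. }
    apply (beta_nonzero r1 H1); pose proof (HF r1 H1); lra.
  - apply (Hwlog r2 r1 Ha H2); intros t Ht; pose proof (HC t Ht); lra.
Qed.

Lemma listed_of_classifying a b c kappa : (a <> 0 \/ b <> 0 \/ c <> 0) ->
  classifying (dom E) (beta E) a b c kappa -> listed.
Proof.
  intros Hnz HC; destruct (Req_dec a 0) as [->|Ha].
  - destruct (Req_dec b 0) as [->|Hb].
    + apply (listed_of_constant_tau c kappa); [lra | exact HC].
    + apply (listed_of_linear_tau b (- c / b) kappa Hb).
      replace (- b * (- c / b)) with c by (field; exact Hb); exact HC.
  - destruct (Rlt_or_le (b ^ 2 - 4 * a * c) 0) as [Hd|Hd].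
    + exact (listed_of_no_root a b c kappa Ha Hd HC).
    + set (s := sqrt (b ^ 2 - 4 * a * c)).
      assert (Hs : s ^ 2 = b ^ 2 - 4 * a * c) by (apply pow2_sqrt, Hd).
      apply (listed_of_quadratic_tau a ((- b - s) / (2 * a)) ((- b + s) / (2 * a))
               kappa Ha).
      replace (- a * _) with b by (field; exact Ha).
      replace (a * ((- b - s) / (2 * a)) * ((- b + s) / (2 * a)))
        with ((b ^ 2 - s ^ 2) / (4 * a)) by (field; exact Ha).
      rewrite Hs; replace (_ / _) with c by (field; exact Ha); exact HC.
Qed.
End Equivalence.

(** * Normalization of the parameters *)

Lemma power_normalization rho I : case_interval (Power rho) I ->
  exists rho' I', rho' <= 3 / 2 /\ case_interval (Power rho') I' /\
    equivalent (Eqn I (case_beta (Power rho))) (Eqn I' (case_beta (Power rho'))).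
Proof.
  intros HI; destruct (Rle_dec rho (3 / 2)) as [Hle|Hgt].
  - exists rho, I; split; [exact Hle|split; [exact HI | apply equivalent_refl]].
  (* The inversion [1 / t] turns [t d/dt] into its negative, so with [kappa = rho - 3/2] preserved
     the exponent becomes [3 - rho]. *)
  - destruct (equivalent_of_solution (Eqn I (case_beta (Power rho))) (proj1 HI)
      (fun t Ht => case_beta_derivable _ t (proj2 HI t Ht))
      (fun t _ => Rgt_not_eq _ _ (case_beta_pos _ t))
      (Power (3 - rho)) 0 1 1 0 0 (-1) 0 0 1 0 (rho - 3 / 2)) as (I' & HI' & Heq);
      try lra.
    + intros t Ht; apply HI in Ht; simpl in *; lra.
    + intros t Ht; apply HI in Ht; unfold moebius; simpl in *.
      apply Rdiv_lt_0_compat; lra.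
    + simpl; lra.
    + intros t Ht; apply HI in Ht; simpl in *; lra.
    + apply (case_solution_classifying (Power rho)); [apply HI | simpl; lra].
    + exists (3 - rho), I'; split; [lra | auto].
Qed.

Lemma arctan_normalization nu I : case_interval (Arctan nu) I ->
  exists nu' I', 0 <= nu' /\ case_interval (Arctan nu') I' /\
    equivalent (Eqn I (case_beta (Arctan nu))) (Eqn I' (case_beta (Arctan nu'))).
Proof.
  intros HI; destruct (Rle_dec 0 nu) as [Hle|Hgt].
  - exists nu, I; split; [exact Hle|split; [exact HI | apply equivalent_refl]].
  (* The reflection of [t] reverses [(t^2 + 1) d/dt], so preserving [kappa = 5 nu] changes the sign
     of [nu]. *)
  - destruct (equivalent_of_solution (Eqn I (case_beta (Arctan nu))) (proj1 HI)
      (fun t Ht => case_beta_derivable _ t (proj2 HI t Ht))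
      (fun t _ => Rgt_not_eq _ _ (case_beta_pos _ t))
      (Arctan (- nu)) (-1) 0 0 1 (-1) 0 (-1) 1 0 1 (5 * nu)) as (I' & HI' & Heq);
      try lra.
    + intros; lra.
    + intros; exact Logic.I.
    + simpl; lra.
    + intros t _; nra.
    + apply (case_solution_classifying (Arctan nu)); [apply HI | simpl; lra].
    + exists (- nu), I'; split; [lra | auto].
Qed.

Theorem theorem3 (X U : R -> Prop)
    (HX : is_open_interval X) (HU : is_open_interval U) :
  (* the kernel is the two-dimensional Abelian algebra A_ker *)
  (forall I : R -> Prop, is_open_interval I ->
     (forall Q : vfield, kernel I X U Q <-> A_ker I X U Q) /\
     lin_indep (box I X U) ker_basis /\
     (forall Q1 Q2 : vfield, A_ker I X U Q1 -> A_ker I X U Q2 ->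
        vf_eq_on (box I X U) (bracket Q1 Q2) vf_zero)) /\
  (* the listed cases are extensions, with the listed algebras *)
  (forall (c : case) (I : R -> Prop), case_param c -> case_interval c I ->
     (forall Q : vfield,
        A_max X U (Eqn I (case_beta c)) Q
        <-> in_span (box I X U) (case_basis c) Q) /\
     extends_kernel X U (Eqn I (case_beta c))) /\
  (* every extension is equivalent to a listed case *)
  (forall E : equation, in_class E -> extends_kernel X U E ->
     exists (c : case) (I : R -> Prop),
       case_param c /\ case_interval c I /\
       equivalent E (Eqn I (case_beta c))) /\
  (* the listed cases are pairwise inequivalent *)
  (forall (c c' : case) (I I' : R -> Prop),
     case_param c -> case_param c' ->
     case_interval c I -> case_interval c' I' ->
     equivalent (Eqn I (case_beta c)) (Eqn I' (case_beta c')) -> c = c') /\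
  (* the normalizations rho <= 3/2 and nu >= 0 are available *)
  (forall (rho : R) (I : R -> Prop), case_interval (Power rho) I ->
     exists (rho' : R) (I' : R -> Prop),
       rho' <= 3 / 2 /\ case_interval (Power rho') I' /\
       equivalent (Eqn I (case_beta (Power rho)))
                  (Eqn I' (case_beta (Power rho')))) /\
  (forall (nu : R) (I : R -> Prop), case_interval (Arctan nu) I ->
     exists (nu' : R) (I' : R -> Prop),
       0 <= nu' /\ case_interval (Arctan nu') I' /\
       equivalent (Eqn I (case_beta (Arctan nu)))
                  (Eqn I' (case_beta (Arctan nu')))).
Proof.
  split; [intros I HI; split; [|split]|].
  - intros Q; exact (kernel_eq_A_ker I X U Q HI HX HU).
  - exact (ker_basis_lin_indep I X U HI HX HU).
  - intros Q1 Q2; exact (A_ker_abelian I X U Q1 Q2 HI HX HU).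
  - split; [intros c I Hp HI; split|].
    + intros Q; exact (A_max_case c I X U Q HX HU Hp HI).
    + exact (case_extends c I X U HX HU Hp HI).
    + split; [|split; [exact equivalent_cases_eq|split]].
      * intros E HE Hext.
        destruct (extension_classifying E X U HX HU HE Hext)
          as (a & b & c & kappa & Hnz & HC).
        pose proof (fun t Ht => in_class_derivable E t HE Ht) as Hd.
        destruct HE as (HI & _ & Hn).
        exact (listed_of_classifying E HI (fun t Ht => proj1 (Hd t Ht)) Hn
                 (fun t Ht => proj2 (Hd t Ht)) a b c kappa Hnz HC).
      * exact power_normalization.
      * exact arctan_normalization.
Qed.
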